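(* Let $X=(X(k,l))_{k,l\ge0}$ be a family of sets. With the symmetric group actions, horizontal concatenation and partial trace maps on (isomorphism classes of) graphs described in the context, the families $\mathrm{Gr}$ (graphs), $\mathrm{CGr}$ (corolla ordered graphs), $\mathrm{Gr}(X)$ ($X$-decorated graphs) and $\mathrm{CGr}(X)$ ($X$-decorated corolla ordered graphs) are unitary TRAPs.
   Context: Notation: $\mathbb{N}_0=\{0,1,2,\dots\}$, $[k]=\{1,\dots,k\}$, $\mathfrak S_k$ is the symmetric group on $[k]$. TRAP. A TRAP is a family $P=(P(k,l))_{k,l\ge 0}$ of sets with: (1) for all $k,l\in\mathbb N_0$, a left action of $\mathfrak S_l$ and a right action of $\mathfrak S_k$ on $P(k,l)$ which commute (this is called an $\mathfrak S\times\mathfrak S^{op}$-module). (2) Maps $*:P(k,l)\times P(k',l')\to P(k+k',l+l')$ (horizontal concatenation) such that: $*$ is associative; there is $I_0\in P(0,0)$ with $I_0*p=p*I_0=p$; $(\sigma\cdot p\cdot\tau)*(\sigma'\cdot p'\cdot\tau')=(\sigma\otimes\sigma')\cdot(p*p')\cdot(\tau\otimes\tau')$, where for $\alpha\in\mathfrak S_m,\beta\in\mathfrak S_n$, $(\alpha\otimes\beta)(i)=\alpha(i)$ if $i\le m$ and $\beta(i-m)+m$ if $i>m$; and $c_{l,l'}\cdot(p*p')=(p'*p)\cdot c_{k,k'}$ for $p\in P(k,l)$, $p'\in P(k',l')$, where $c_{m,n}\in\mathfrak S_{m+n}$, $c_{m,n}(i)=i+n$ if $i\le m$ and $i-m$ if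 $i>m$. (3) For $k,l\ge1$, $i\in[k]$, $j\in[l]$, maps $t_{i,j}:P(k,l)\to P(k-1,l-1)$ (partial trace maps) such that: (a) for $k,l\ge2$, $i\in[k]$, $j\in[l]$, $i'\in[k-1]$, $j'\in[l-1]$: $t_{i',j'}\circ t_{i,j}$ equals $t_{i-1,j-1}\circ t_{i',j'}$ if $i'<i,j'<j$; $t_{i,j-1}\circ t_{i'+1,j'}$ if $i'\ge i,j'<j$; $t_{i-1,j}\circ t_{i',j'+1}$ if $i'<i,j'\ge j$; $t_{i,j}\circ t_{i'+1,j'+1}$ if $i'\ge i,j'\ge j$. (b) $t_{i,j}(\sigma\cdot p\cdot\tau)=\sigma_j\cdot t_{\tau(i),\sigma^{-1}(j)}(p)\cdot\tau_{\tau(i)}$, where for $\alpha\in\mathfrak S_n$ and $q\in[n]$, $\alpha_q\in\mathfrak S_{n-1}$ is the permutation whose word is obtained from the word $\alpha(1)\dots\alpha(n)$ by deleting the letter $q$ and subtracting $1$ from all letters $>q$. (c) for $p\in P(k,l)$, $p'\in P(k',l')$ ($k,l,k',l'\ge0$), $i\in[k+k']$, $j\in[l+l']$: $t_{i,j}(p*p')=t_{i,j}(p)*p'$ if $i\le k,j\le l$, and $t_{i,j}(p*p')=p*t_{i-k,j-l}(p')$ if $i>k,j>l$. The TRAP is unitary if there is $I\in P(1,1)$ such that for all $k,l\ge0$ and $p\in P(k,l)$: $t_{1,j}(I*p)=(1,2,\dots,j-1)\cdot p$ for $2\le j\le l+1$; $t_{i,1}(I*p)=p\cdot(1,2,\dots,i-1)^{-1}$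 for $2\le i\le k+1$; $t_{k+1,j}(p*I)=(j,j+1,\dots,l)^{-1}\cdot p$ for $1\le j\le l$; $t_{i,l+1}(p*I)=p\cdot(i,i+1,\dots,k)$ for $1\le i\le k$ (here $(a,\dots,b)$ denotes a cycle). Graphs. A graph $G$ consists of finite (possibly empty) sets $V(G)$ (vertices), $E(G)$ (internal edges), $I(G)$ (input edges), $O(G)$ (output edges), $IO(G)$ (input-output edges), $L(G)$ (loops, i.e. edges with no endpoints), a source map $s:E(G)\sqcup O(G)\to V(G)$, a target map $t:E(G)\sqcup I(G)\to V(G)$, and bijections $\alpha:I(G)\sqcup IO(G)\to[i(G)]$, $\beta:O(G)\sqcup IO(G)\to[o(G)]$ (indexations of inputs and outputs), where $i(G)=|I(G)|+|IO(G)|$, $o(G)=|O(G)|+|IO(G)|$. The incoming (outgoing) edges of a vertex $v$ are the elements of $t^{-1}(v)$ (of $s^{-1}(v)$), their number is $i(v)$ (resp. $o(v)$). A corolla ordered graph is a graph with, for each vertex $v$, a total order on its incoming edges and a total order on its outgoing edges. An $X$-decorated graph is a graph with a map $d_G$ on $V(G)$ with $d_G(v)\in X(i(v),o(v))$. Isomorphisms are families of bijections between the six sets respecting $s,t,\alpha,\beta$ (and the orders, resp. decorations, when present). $\mathrm{Gr}(k,l)$, $\mathrm{CGr}(k,l)$, $\mathrm{Gr}(X)(k,l)$, $\mathrm{CGr}(X)(k,l)$ are the sets of isomorphism classes of graphs, corolla ordered graphs, $X$-decorated graphs, $X$-decorated corolla ordered graphs with $i(G)=k$, $o(G)=l$.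 Structure. For $\tau\in\mathfrak S_l$, $\sigma\in\mathfrak S_k$, $\tau\cdot G\cdot\sigma$ is $G$ with $\alpha,\beta$ replaced by $\sigma^{-1}\circ\alpha$, $\tau\circ\beta$. $G*G'$ is the disjoint union, the input (output) labels of $G'$ being shifted by $i(G)$ (by $o(G)$); $I_0$ is the empty graph. For $t_{i,j}(G)$: let $e=\alpha^{-1}(i)$, $f=\beta^{-1}(j)$; remove $e$ and $f$ and add one new edge $g$: if $e\in I(G),f\in O(G)$, $g$ is internal with source $s(f)$ and target $t(e)$; if $e\in IO(G),f\in O(G)$, $g$ is an output edge with source $s(f)$ and output label $\beta(e)$; if $e\in I(G),f\in IO(G)$, $g$ is an input edge with target $t(e)$ and input label $\alpha(f)$; if $e\ne f$ are both in $IO(G)$, $g$ is an input-output edge with input label $\alpha(f)$ and output label $\beta(e)$; if $e=f\in IO(G)$, $g$ is a loop. Then all input labels $>i$ and output labels $>j$ are decreased by $1$. Decorations are kept; in the corolla ordered case $g$ takes the position of $f$ among outgoing edges of $s(f)$ and of $e$ among incoming edges of $t(e)$. The graph $I$ is the graph with a single edge, which is an input-output edge, and no vertex. *)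

(* Defs.v *)
(* Written over MathComp (finite types and permutations). *)
From mathcomp Require Import all_boot all_fingroup.
From mathcomp Require Import zify.

Set Implicit Arguments.
Unset Strict Implicit.
Unset Printing Implicit Defensive.

(** * Conventions

   The set [n] = {1, ..., n} is ['I_n], the element i being represented by the
   ordinal of value i - 1.  Products in ['S_n] are those of MathComp:
   [(s * t)%g x = t (s x)], so that the composite s o t is [(t * s)%g]. *)

Definition cast2 (P : nat -> nat -> Type) k l k' l' (ek : k = k') (el : l = l')
    (p : P k l) : P k' l' :=
  match ek in _ = m, el in _ = n return P m n with
  | erefl, erefl => p
  end.

(** * Permutations *)

Lemma unbump_ltn n (i m : 'I_n.+1) : m != i -> unbump i m < n.
Proof.
by move=> nmi; rewrite eq_sym in nmi; have [j -> _] := unlift_some nmi; rewrite /= bumpK.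
Qed.

(* The position of m in the set [n+1] with i removed: m, minus 1 if m > i. *)
Definition unlift_ne n (i m : 'I_n.+1) (nmi : m != i) : 'I_n :=
  Ordinal (unbump_ltn nmi).

Lemma lift_unlift_ne n (i m : 'I_n.+1) (nmi : m != i) :
  lift i (unlift_ne nmi) = m.
Proof. by apply: val_inj; rewrite /= unbumpKcond (inj_eq val_inj) (negPf nmi). Qed.

Lemma unlift_ne_inj n (i m m' : 'I_n.+1) (nmi : m != i) (nmi' : m' != i) :
  unlift_ne nmi = unlift_ne nmi' -> m = m'.
Proof. by move=> eqm; rewrite -(lift_unlift_ne nmi) eqm lift_unlift_ne. Qed.

Definition tensor_fun m n (s : 'S_m) (t : 'S_n) (x : 'I_(m + n)) : 'I_(m + n) :=
  match split x with
  | inl i => lshift n (s i)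
  | inr j => rshift m (t j)
  end.

Lemma tensor_fun_inj m n (s : 'S_m) (t : 'S_n) : injective (tensor_fun s t).
Proof.
move=> x y; rewrite -(splitK x) -(splitK y) /tensor_fun !unsplitK.
by case: (split x) => i; case: (split y) => j /eqP /=;
   rewrite ?eq_lshift ?eq_rshift ?eq_lrshift ?eq_rlshift // => /eqP/perm_inj ->.
Qed.

Definition tensor_perm m n (s : 'S_m) (t : 'S_n) : 'S_(m + n) :=
  perm (@tensor_fun_inj m n s t).

(* c_(m,n) : i |-> i + n if i <= m, and i - m otherwise. *)
Definition swap_fun m n (x : 'I_(m + n)) : 'I_(m + n) :=
  match split x with
  | inl i => cast_ord (addnC n m) (rshift n i)
  | inr j => cast_ord (addnC n m) (lshift m j)
  end.

Lemma swap_fun_inj m n : injective (@swap_fun m n).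
Proof.
move=> x y; rewrite -(splitK x) -(splitK y) /swap_fun !unsplitK.
by case: (split x) => i; case: (split y) => j /cast_ord_inj /eqP /=;
   rewrite ?eq_lshift ?eq_rshift ?eq_lrshift ?eq_rlshift // => /eqP ->.
Qed.

Definition swap_perm m n : 'S_(m + n) := perm (@swap_fun_inj m n).

(* Deleting the letter q from the word of s removes the entry in position
   s^-1(q); the remaining letters are renumbered. *)
Lemma perm_del_ne n (s : 'S_n.+1) (q : 'I_n.+1) (m : 'I_n) :
  s (lift ((s^-1)%g q) m) != q.
Proof.
rewrite -{2}(permKV s q) (inj_eq (@perm_inj _ s)) eq_sym.
exact: neq_lift.
Qed.

Definition perm_del_fun n (s : 'S_n.+1) (q : 'I_n.+1) (m : 'I_n) : 'I_n :=
  unlift_ne (perm_del_ne s q m).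

Lemma perm_del_fun_inj n (s : 'S_n.+1) (q : 'I_n.+1) :
  injective (perm_del_fun s q).
Proof. by move=> x y /unlift_ne_inj/perm_inj/lift_inj. Qed.

Definition perm_del n (s : 'S_n.+1) (q : 'I_n.+1) : 'S_n :=
  perm (@perm_del_fun_inj n s q).

(* The cycle (a, a+1, ..., b), with 0-based a and b; it is only used with
   a <= b < n, and is the identity otherwise. *)
Lemma cycle_fun_ltn n (a b : nat) (x : 'I_n) :
  (if (b < n) && (a <= x <= b) then if x == b :> nat then a else x.+1 else x)
    < n.
Proof.
case: ifP => [/andP[bn /andP[ax xb]]|//]; case: eqP => [_|/eqP nxb].
  exact: leq_ltn_trans ax _.
by apply: leq_ltn_trans bn; rewrite ltn_neqAle nxb.
Qed.

Definition cycle_fun n (a b : nat) (x : 'I_n) : 'I_n :=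
  Ordinal (cycle_fun_ltn a b x).

Lemma cycle_fun_inj n (a b : nat) : injective (@cycle_fun n a b).
Proof.
move=> x y /(congr1 val) /= eqxy; apply: val_inj => /=; move: eqxy.
by do ![case: ifP => [|] /=]; lia.
Qed.
Definition cycle_perm n (a b : nat) : 'S_n := perm (@cycle_fun_inj n a b).

(** * TRAPs *)

(* [ptr i j] is the partial trace map t_(i,j), defined on P(k+1, l+1) to avoid
   the side conditions k, l >= 1. *)
Record trap_ops (P : nat -> nat -> Type) := TrapOps {
  lact : forall k l, 'S_l -> P k l -> P k l;
  ract : forall k l, P k l -> 'S_k -> P k l;
  hcat : forall k l k' l', P k l -> P k' l' -> P (k + k') (l + l');
  hone : P 0 0;
  ptr : forall k l, 'I_k.+1 -> 'I_l.+1 -> P k.+1 l.+1 -> P k l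
}.

Arguments lact {P} _ {k l}.
Arguments ract {P} _ {k l}.
Arguments hcat {P} _ {k l k' l'}.
Arguments hone {P}.
Arguments ptr {P} _ {k l}.

Record is_trap (P : nat -> nat -> Type) (T : trap_ops P) : Prop := IsTrap {
  lact1 : forall k l (p : P k l), lact T 1%g p = p;
  lactM : forall k l (s t : 'S_l) (p : P k l),
    lact T s (lact T t p) = lact T (t * s)%g p;
  ract1 : forall k l (p : P k l), ract T p 1%g = p;
  ractM : forall k l (s t : 'S_k) (p : P k l),
    ract T (ract T p s) t = ract T p (t * s)%g;
  lractC : forall k l (s : 'S_l) (t : 'S_k) (p : P k l),
    ract T (lact T s p) t = lact T s (ract T p t);

  hcatA : forall k l k' l' k'' l'' (p : P k l) (p' : P k' l') (p'' : P k'' l''),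
    hcat T p (hcat T p' p'') =
    cast2 (esym (addnA k k' k'')) (esym (addnA l l' l''))
      (hcat T (hcat T p p') p'');
  hcat1p : forall k l (p : P k l), hcat T (hone T) p = p;
  hcatp1 : forall k l (p : P k l),
    cast2 (addn0 k) (addn0 l) (hcat T p (hone T)) = p;
  hcat_act : forall k l k' l' (s : 'S_l) (p : P k l) (t : 'S_k)
      (s' : 'S_l') (p' : P k' l') (t' : 'S_k'),
    hcat T (ract T (lact T s p) t) (ract T (lact T s' p') t') =
    ract T (lact T (tensor_perm s s') (hcat T p p')) (tensor_perm t t');
  hcatC : forall k l k' l' (p : P k l) (p' : P k' l'),
    lact T (swap_perm l l') (hcat T p p') =
    ract T (cast2 (addnC k' k) (addnC l' l) (hcat T p' p)) (swap_perm k k');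

  ptr_ptr_ltlt : forall k l (p : P k.+2 l.+2)
      (i : 'I_k.+2) (j : 'I_l.+2) (i' : 'I_k.+1) (j' : 'I_l.+1),
    i' < i -> j' < j ->
    ptr T i' j' (ptr T i j p) =
    ptr T (inord i.-1) (inord j.-1) (ptr T (inord i') (inord j') p);
  ptr_ptr_gelt : forall k l (p : P k.+2 l.+2)
      (i : 'I_k.+2) (j : 'I_l.+2) (i' : 'I_k.+1) (j' : 'I_l.+1),
    i' >= i -> j' < j ->
    ptr T i' j' (ptr T i j p) =
    ptr T (inord i) (inord j.-1) (ptr T (inord i'.+1) (inord j') p);
  ptr_ptr_ltge : forall k l (p : P k.+2 l.+2)
      (i : 'I_k.+2) (j : 'I_l.+2) (i' : 'I_k.+1) (j' : 'I_l.+1),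
    i' < i -> j' >= j ->
    ptr T i' j' (ptr T i j p) =
    ptr T (inord i.-1) (inord j) (ptr T (inord i') (inord j'.+1) p);
  ptr_ptr_gege : forall k l (p : P k.+2 l.+2)
      (i : 'I_k.+2) (j : 'I_l.+2) (i' : 'I_k.+1) (j' : 'I_l.+1),
    i' >= i -> j' >= j ->
    ptr T i' j' (ptr T i j p) =
    ptr T (inord i) (inord j) (ptr T (inord i'.+1) (inord j'.+1) p);
  ptr_act : forall k l (s : 'S_l.+1) (p : P k.+1 l.+1) (t : 'S_k.+1)
      (i : 'I_k.+1) (j : 'I_l.+1),
    ptr T i j (ract T (lact T s p) t) =
    ract T (lact T (perm_del s j) (ptr T (t i) ((s^-1)%g j) p))
      (perm_del t (t i));
  ptr_hcatl : forall k l k' l' (p : P k.+1 l.+1) (p' : P k' l')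
      (i : 'I_k.+1) (j : 'I_l.+1),
    @ptr P T (k + k') (l + l') (lshift k' i) (lshift l' j) (hcat T p p') =
    hcat T (ptr T i j p) p';
  ptr_hcatr : forall k l k' l' (p : P k l) (p' : P k'.+1 l'.+1)
      (i : 'I_k'.+1) (j : 'I_l'.+1),
    ptr T (cast_ord (addnS k k') (rshift k i))
          (cast_ord (addnS l l') (rshift l j))
          (cast2 (addnS k k') (addnS l l') (hcat T p p')) =
    hcat T p (ptr T i j p')
}.

(* The indices i and j are 0-based, and so are the cycles. *)
Record is_unit (P : nat -> nat -> Type) (T : trap_ops P) (I : P 1 1) : Prop :=
  IsUnit {
  ptr_unitl_out : forall k l (p : P k l) (j : 'I_l.+1), 0 < j ->
    @ptr P T k l ord0 j (hcat T I p) = lact T (cycle_perm l 0 j.-1) p;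
  ptr_unitl_in : forall k l (p : P k l) (i : 'I_k.+1), 0 < i ->
    @ptr P T k l i ord0 (hcat T I p) = ract T p (cycle_perm k 0 i.-1)^-1%g;
  ptr_unitr_out : forall k l (p : P k l) (j : 'I_l.+1), j < l ->
    ptr T ord_max j (cast2 (addn1 k) (addn1 l) (hcat T p I)) =
    lact T (cycle_perm l j l.-1)^-1%g p;
  ptr_unitr_in : forall k l (p : P k l) (i : 'I_k.+1), i < k ->
    ptr T i ord_max (cast2 (addn1 k) (addn1 l) (hcat T p I)) =
    ract T p (cycle_perm k i k.-1)
}.

(** * Graphs *)

(* Since [alpha] and [beta] are bijections, [graph k l] consists of the graphs
   with exactly k elements in I + IO and l elements in O + IO. *)
Record graph (k l : nat) := Graph {
  gV : finType;
  gE : finType;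
  gI : finType;
  gO : finType;
  gIO : finType;
  gL : finType;
  src : gE + gO -> gV;
  tgt : gE + gI -> gV;
  alpha : gI + gIO -> 'I_k;
  beta : gO + gIO -> 'I_l;
  alpha_bij : bijective alpha;
  beta_bij : bijective beta
}.

Arguments Graph {k l gV gE gI gO gIO} gL src tgt {alpha beta}.
Arguments src {k l}.
Arguments tgt {k l}.
Arguments alpha {k l}.
Arguments beta {k l}.

Definition indeg k l (G : graph k l) (v : gV G) : nat := #|[pred x | tgt G x == v]|.
Definition outdeg k l (G : graph k l) (v : gV G) : nat := #|[pred x | src G x == v]|.

Definition msum (A A' B B' : Type) (f : A -> B) (g : A' -> B') (x : A + A') :
    B + B' :=
  match x with inl a => inl (f a) | inr a' => inr (g a') end.

Record giso k l (G H : graph k l) := GIso {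
  fV : gV G -> gV H;
  fE : gE G -> gE H;
  fI : gI G -> gI H;
  fO : gO G -> gO H;
  fIO : gIO G -> gIO H;
  fL : gL G -> gL H;
  fV_bij : bijective fV;
  fE_bij : bijective fE;
  fI_bij : bijective fI;
  fO_bij : bijective fO;
  fIO_bij : bijective fIO;
  fL_bij : bijective fL;
  giso_src : forall x, src H (msum fE fO x) = fV (src G x);
  giso_tgt : forall x, tgt H (msum fE fI x) = fV (tgt G x);
  giso_alpha : forall x, alpha H (msum fI fIO x) = alpha G x;
  giso_beta : forall x, beta H (msum fO fIO x) = beta G x
}.

(** ** Actions of the symmetric groups *)

Lemma graph_lact_bij k l (s : 'S_l) (G : graph k l) : bijective (s \o beta G).
Proof. by apply: bij_comp (beta_bij G); exact: injF_bij (@perm_inj _ s). Qed.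

Lemma graph_ract_bij k l (G : graph k l) (s : 'S_k) :
  bijective ((s^-1)%g \o alpha G).
Proof. by apply: bij_comp (alpha_bij G); exact: injF_bij (@perm_inj _ _). Qed.

Definition graph_lact k l (s : 'S_l) (G : graph k l) : graph k l :=
  Graph (gL G) (src G) (tgt G) (alpha_bij G) (graph_lact_bij s G).

Definition graph_ract k l (G : graph k l) (s : 'S_k) : graph k l :=
  Graph (gL G) (src G) (tgt G) (graph_ract_bij G s) (beta_bij G).

(** ** Disjoint union *)

Definition sumACA (A A' B B' : Type) (x : (A + A') + (B + B')) :
    (A + B) + (A' + B') :=
  match x with
  | inl (inl a) => inl (inl a)
  | inl (inr a') => inr (inl a')
  | inr (inl b) => inl (inr b)
  | inr (inr b') => inr (inr b')
  end.

Lemma sumACA_bij (A A' B B' : Type) : bijective (@sumACA A A' B B').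
Proof. by exists (@sumACA A B A' B') => [[[]|[]]|[[]|[]]]. Qed.

Lemma msum_bij (A A' B B' : Type) (f : A -> B) (g : A' -> B') :
  bijective f -> bijective g -> bijective (msum f g).
Proof.
move=> [f' fK f'K] [g' gK g'K].
by exists (msum f' g') => [[]|[]] x /=; rewrite ?fK ?f'K ?gK ?g'K.
Qed.

Lemma unsplit_bij m n : bijective (@unsplit m n).
Proof. by exists (@split m n); [exact: unsplitK | exact: splitK]. Qed.

Section Cat.
Variables (k l k' l' : nat) (G : graph k l) (H : graph k' l').

Definition cat_src := msum (src G) (src H) \o @sumACA _ _ _ _.
Definition cat_tgt := msum (tgt G) (tgt H) \o @sumACA _ _ _ _.
Definition cat_alpha := @unsplit k k' \o msum (alpha G) (alpha H) \o @sumACA _ _ _ _.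
Definition cat_beta := @unsplit l l' \o msum (beta G) (beta H) \o @sumACA _ _ _ _.

Lemma cat_alpha_bij : bijective cat_alpha.
Proof.
apply: bij_comp (sumACA_bij _ _ _ _); apply: bij_comp (unsplit_bij _ _) _.
exact: msum_bij (alpha_bij G) (alpha_bij H).
Qed.

Lemma cat_beta_bij : bijective cat_beta.
Proof.
apply: bij_comp (sumACA_bij _ _ _ _); apply: bij_comp (unsplit_bij _ _) _.
exact: msum_bij (beta_bij G) (beta_bij H).
Qed.

Definition graph_cat : graph (k + k') (l + l') :=
  Graph (gL G + gL H)%type
    (cat_src : (gE G + gE H) + (gO G + gO H) -> gV G + gV H)%type
    (cat_tgt : (gE G + gE H) + (gI G + gI H) -> gV G + gV H)%type
    (cat_alpha_bij : bijective
       (cat_alpha : (gI G + gI H) + (gIO G + gIO H) -> 'I_(k + k'))%type)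
    cat_beta_bij.

End Cat.

(** ** The empty graph and the graph reduced to one input-output edge *)

Definition void_fun (x : void + void) : 'I_0 :=
  match x with inl y | inr y => of_void _ y end.

Lemma void_bij : bijective void_fun.
Proof.
have F0 (x : 'I_0) : False by case: x.
by exists (fun x => False_rect _ (F0 x)) => [[[]|[]]|x]; case: (F0 x).
Qed.

Definition graph_empty : graph 0 0 :=
  @Graph 0 0 void void void void void void
    (fun x => match x with inl y | inr y => y end)
    (fun x => match x with inl y | inr y => y end)
    void_fun void_fun void_bij void_bij.

Lemma wire_bij : bijective (fun _ : void + unit => ord0 : 'I_1).
Proof. by exists (fun=> inr tt) => [[[]|[]]|x] //; rewrite (ord1 x). Qed.

Definition graph_wire : graph 1 1 :=
  @Graph 1 1 void void void void unit void
    (fun x => match x with inl y | inr y => y end)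
    (fun x => match x with inl y | inr y => y end)
    (fun=> ord0) (fun=> ord0) wire_bij wire_bij.

(** ** Partial traces *)

(* The edges of the graph obtained from G by joining the input e to the
   output f, together with the bookkeeping of their ends and labels:
   - [end_in] ([end_out]) sends an edge with a target (source) to the edge of
     G which occupies the same place at that vertex, so that the new edge g has
     the target of e and the source of f;
   - [lab_in] ([lab_out]) sends an edge with an input (output) label to the
     edge of G from which the label comes, so that g has the input label of f
     and the output label of e. *)
Record joining k l (G : graph k l) := Joining {
  jE : finType;
  jI : finType;
  jO : finType;
  jIO : finType;
  jL : finType;
  end_in : jE + jI -> gE G + gI G;
  end_out : jE + jO -> gE G + gO G;
  lab_in : jI + jIO -> gI G + gIO G;
  lab_out : jO + jIO -> gO G + gIO G
}.

Arguments end_in {k l G}.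
Arguments end_out {k l G}.
Arguments lab_in {k l G}.
Arguments lab_out {k l G}.

Section Join.
Variables (k l : nat) (G : graph k l).

(* In all cases the new edge g is [None]. *)

Definition join_I_O (e : gI G) (f : gO G) : joining G :=
  @Joining k l G (option (gE G)) {x | x != e} {x | x != f} (gIO G) (gL G)
    (fun x => match x with
              | inl None => inr e
              | inl (Some y) => inl y
              | inr y => inr (val y)
              end)
    (fun x => match x with
              | inl None => inr f
              | inl (Some y) => inl y
              | inr y => inr (val y)
              end)
    (msum val id) (msum val id).

Definition join_IO_O (e : gIO G) (f : gO G) : joining G :=
  @Joining k l G (gE G) (gI G) (option {x | x != f}) {x | x != e} (gL G)
    id
    (fun x => match x with
              | inl y => inl y
              | inr None => inr f
              | inr (Some y) => inr (val y)
              end)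
    (msum id val)
    (fun x => match x with
              | inl None => inr e
              | inl (Some y) => inl (val y)
              | inr y => inr (val y)
              end).

Definition join_I_IO (e : gI G) (f : gIO G) : joining G :=
  @Joining k l G (gE G) (option {x | x != e}) (gO G) {x | x != f} (gL G)
    (fun x => match x with
              | inl y => inl y
              | inr None => inr e
              | inr (Some y) => inr (val y)
              end)
    id
    (fun x => match x with
              | inl None => inr f
              | inl (Some y) => inl (val y)
              | inr y => inr (val y)
              end)
    (msum id val).

Definition join_IO_IO (e f : gIO G) : joining G :=
  @Joining k l G (gE G) (gI G) (gO G)
    (option {x | (x != e) && (x != f)}) (gL G)
    id id
    (msum id (fun x => match x with None => f | Some y => val y end))
    (msum id (fun x => match x with None => e | Some y => val y end)).

Definition join_loop (e : gIO G) : joining G :=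
  @Joining k l G (gE G) (gI G) (gO G) {x | x != e} (option (gL G))
    id id (msum id val) (msum id val).

Definition join (e : gI G + gIO G) (f : gO G + gIO G) : joining G :=
  match e, f with
  | inl e, inl f => join_I_O e f
  | inr e, inl f => join_IO_O e f
  | inl e, inr f => join_I_IO e f
  | inr e, inr f => if e == f then join_loop e else join_IO_IO e f
  end.

Lemma inj_surj_bij (A : choiceType) (B : eqType) (h : A -> B) :
  injective h -> (forall y, exists x, h x = y) -> bijective h.
Proof.
move=> h_inj h_surj.
have hP y : exists x, h x == y by have [x <-] := h_surj y; exists x.
have hK : cancel (fun y => xchoose (hP y)) h by move=> y; apply/eqP/(xchooseP (hP y)).
by exists (fun y => xchoose (hP y)) => // x; apply: h_inj; rewrite hK.
Qed.

(* Bijective onto the complement of b. *)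
Definition bij_but (A B : eqType) (b : B) (h : A -> B) : Prop :=
  [/\ injective h, forall x, h x != b & forall y, y != b -> exists x, h x = y].

(* Injectivity of maps between sums and subtypes, by cases. *)
Ltac solve_inj :=
  let x := fresh "x" in let y := fresh "y" in let xy := fresh "xy" in
  intros x y;
  repeat match goal with z : ?T |- _ =>
    let T' := eval hnf in T in
    match T' with
    | sum _ _ => destruct z
    | option _ => destruct z
    | sig _ => destruct z
    end
  end; cbn in *; intros xy; try discriminate xy;
  try (injection xy; intros); subst;
  try (by exfalso; repeat match goal with z : is_true _ |- _ => move: z end;
          rewrite ?eqxx ?andbF);
  try ((congr (inl (Some _)) || congr (inr (Some _)) || congr (inl _) ||
        congr (inr _)); exact: val_inj);
  try done.

Lemma end_in_bij e f : bijective (end_in (join e f)).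
Proof.
case: e f => e [] f /=; try by exists id.
- apply: inj_surj_bij; first by solve_inj.
  case=> y; first by exists (inl (Some y)).
  have [->|ye] := eqVneq y e; first by exists (inl None).
  by exists (inr (exist _ y ye)).
- apply: inj_surj_bij; first by solve_inj.
  case=> y; first by exists (inl y).
  have [->|ye] := eqVneq y e; first by exists (inr None).
  by exists (inr (Some (exist _ y ye))).
- by case: eqP => _; exists id.
Qed.

Lemma end_out_bij e f : bijective (end_out (join e f)).
Proof.
case: e f => e [] f /=; try by exists id.
- apply: inj_surj_bij; first by solve_inj.
  case=> y; first by exists (inl (Some y)).
  have [->|yf] := eqVneq y f; first by exists (inl None).
  by exists (inr (exist _ y yf)).
- apply: inj_surj_bij; first by solve_inj.
  case=> y; first by exists (inl y).
  have [->|yf] := eqVneq y f; first by exists (inr None).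
  by exists (inr (Some (exist _ y yf))).
- by case: eqP => _; exists id.
Qed.

Lemma lab_in_bij_but e f : bij_but e (lab_in (join e f)).
Proof.
case: e f => e [] f /=; try (case: ifP => [/eqP ef|/negbT ef]; [subst f|]) => /=; split;
  try solve_inj; try by [case=> [[[x xe]|]|[x xe]] | case=> [x|[x xe]]
                         | case=> [[x xe]|x]].
- by case=> y ye; [exists (inl (exist _ y ye)) | exists (inr y)].
- case=> y ye; first by exists (inl (Some (exist _ y ye))).
  have [->|yf] := eqVneq y f; first by exists (inl None).
  by exists (inr (exist _ y yf)).
- by case=> y ye; [exists (inl y) | exists (inr (exist _ y ye))].
- by case=> y ye; [exists (inl y) | exists (inr (exist _ y ye))].
- by case=> [x|[[x /= /andP[xe xf]]|]] //=; apply: contra ef => /eqP[->].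
- case=> y ye; first by exists (inl y).
  have [->|yf] := eqVneq y f; first by exists (inr None).
  have yef : (y != e) && (y != f) by rewrite yf andbT.
  by exists (inr (Some (exist _ y yef))).
Qed.

Lemma lab_out_bij_but e f : bij_but f (lab_out (join e f)).
Proof.
case: e f => e [] f /=; try (case: ifP => [/eqP ef|/negbT ef]; [subst f|]) => /=; split;
  try solve_inj; try by [case=> [[[x xe]|]|[x xe]] | case=> [x|[x xe]]
                         | case=> [[x xe]|x]].
- by case=> y yf; [exists (inl (exist _ y yf)) | exists (inr y)].
- by case=> y yf; [exists (inl y) | exists (inr (exist _ y yf))].
- case=> y yf; first by exists (inl (Some (exist _ y yf))).
  have [->|ye] := eqVneq y e; first by exists (inl None).
  by exists (inr (exist _ y ye)).
- by case=> y ye; [exists (inl y) | exists (inr (exist _ y ye))].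
- by case=> [x|[[x /= /andP[xe xf]]|]] //=; apply: contra ef => /eqP[->].
- case=> y yf; first by exists (inl y).
  have [->|ye] := eqVneq y e; first by exists (inr None).
  have yef : (y != e) && (y != f) by rewrite ye.
  by exists (inr (Some (exist _ y yef))).
Qed.

End Join.

Section GraphJoin.
Variables (k l : nat) (G : graph k.+1 l.+1).
Variables (e : gI G + gIO G) (f : gO G + gIO G).

Let J := join e f.

Lemma lab_in_ne (x : jI J + jIO J) : alpha G (lab_in J x) != alpha G e.
Proof.
by have [_ + _] := lab_in_bij_but e f; rewrite (inj_eq (bij_inj (alpha_bij G))).
Qed.

Lemma lab_out_ne (x : jO J + jIO J) : beta G (lab_out J x) != beta G f.
Proof.
by have [_ + _] := lab_out_bij_but e f; rewrite (inj_eq (bij_inj (beta_bij G))).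
Qed.

Definition join_alpha x : 'I_k := unlift_ne (lab_in_ne x).
Definition join_beta x : 'I_l := unlift_ne (lab_out_ne x).

Lemma join_alpha_bij : bijective join_alpha.
Proof.
have [h_inj h_ne h_surj] := lab_in_bij_but e f.
apply: inj_surj_bij => [x y /unlift_ne_inj/(bij_inj (alpha_bij G))/h_inj //|m].
have [a aK Ka] := alpha_bij G.
have [|x hx] := h_surj (a (lift (alpha G e) m)).
  by rewrite -(inj_eq (can_inj aK)) Ka eq_sym neq_lift.
exists x; apply: (@lift_inj _ (alpha G e)).
by rewrite lift_unlift_ne hx Ka.
Qed.

Lemma join_beta_bij : bijective join_beta.
Proof.
have [h_inj h_ne h_surj] := lab_out_bij_but e f.
apply: inj_surj_bij => [x y /unlift_ne_inj/(bij_inj (beta_bij G))/h_inj //|m].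
have [b bK Kb] := beta_bij G.
have [|x hx] := h_surj (b (lift (beta G f) m)).
  by rewrite -(inj_eq (can_inj bK)) Kb eq_sym neq_lift.
exists x; apply: (@lift_inj _ (beta G f)).
by rewrite lift_unlift_ne hx Kb.
Qed.

Definition graph_join : graph k l :=
  Graph (jL J) (src G \o end_out J) (tgt G \o end_in J)
    join_alpha_bij join_beta_bij.

End GraphJoin.

Lemma bij_surj (A B : eqType) (h : A -> B) :
  bijective h -> forall y, exists x, h x == y.
Proof. by case=> h' _ hK y; exists (h' y); rewrite hK. Qed.

Definition preim_of (A : choiceType) (B : eqType) (h : A -> B)
    (h_bij : bijective h) (y : B) : A :=
  xchoose (bij_surj h_bij y).

Definition graph_ptr k l (i : 'I_k.+1) (j : 'I_l.+1) (G : graph k.+1 l.+1) :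
    graph k l :=
  graph_join (preim_of (alpha_bij G) i) (preim_of (beta_bij G) j).

(** * Graphs with additional structure *)

(* A kind of structure carried by graphs, with the relation expressing that an
   isomorphism of graphs respects two given structures, and with the structures
   induced on the graphs obtained by each of the operations. *)
Record graph_structure := GraphStructure {
  gs_on :> forall k l, graph k l -> Type;
  gs_iso : forall k l (G H : graph k l), giso G H -> gs_on G -> gs_on H -> Prop;
  gs_lact : forall k l (s : 'S_l) (G : graph k l),
    gs_on G -> gs_on (graph_lact s G);
  gs_ract : forall k l (G : graph k l) (s : 'S_k),
    gs_on G -> gs_on (graph_ract G s);
  gs_cat : forall k l k' l' (G : graph k l) (H : graph k' l'),
    gs_on G -> gs_on H -> gs_on (graph_cat G H);
  gs_empty : gs_on graph_empty;
  gs_wire : gs_on graph_wire;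
  gs_join : forall k l (G : graph k.+1 l.+1)
      (e : gI G + gIO G) (f : gO G + gIO G),
    gs_on G -> gs_on (graph_join e f)
}.

Arguments gs_lact S {k l} s {G} : rename.
Arguments gs_ract S {k l G} s : rename.
Arguments gs_cat S {k l k' l' G H} : rename.
Arguments gs_join S {k l G} e f : rename.

Definition no_structure : graph_structure :=
  @GraphStructure (fun _ _ _ => unit) (fun _ _ _ _ _ _ _ => True)
    (fun _ _ _ _ _ => tt) (fun _ _ _ _ _ => tt) (fun _ _ _ _ _ _ _ _ => tt)
    tt tt (fun _ _ _ _ _ _ => tt).

Definition pair_structure (S T : graph_structure) : graph_structure :=
  @GraphStructure (fun k l G => (S k l G * T k l G)%type)
    (fun k l G H f x y => gs_iso f x.1 y.1 /\ gs_iso f x.2 y.2)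
    (fun k l s G x => (gs_lact S s x.1, gs_lact T s x.2))
    (fun k l G s x => (gs_ract S s x.1, gs_ract T s x.2))
    (fun k l k' l' G H x y => (gs_cat S x.1 y.1, gs_cat T x.2 y.2))
    (gs_empty S, gs_empty T) (gs_wire S, gs_wire T)
    (fun k l G e f x => (gs_join S e f x.1, gs_join T e f x.2)).

(** ** Corolla orders *)

(* A family of total orders on the fibres of h, as the union of these orders:
   elements in distinct fibres are not comparable. *)
Definition fibre_order (A : Type) (B : eqType) (h : A -> B) (R : rel A) : Prop :=
  [/\ reflexive R, antisymmetric R, transitive R
    & forall x y, R x y || R y x = (h x == h y)].

Record corolla_order k l (G : graph k l) := CorollaOrder {
  in_le : rel (gE G + gI G);
  out_le : rel (gE G + gO G);
  in_leP : fibre_order (tgt G) in_le;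
  out_leP : fibre_order (src G) out_le
}.

Arguments in_le {k l G}.
Arguments out_le {k l G}.

Definition corolla_iso k l (G H : graph k l) (f : giso G H)
    (r : corolla_order G) (r' : corolla_order H) : Prop :=
  (forall x y, in_le r' (msum (fE f) (fI f) x) (msum (fE f) (fI f) y) =
               in_le r x y) /\
  (forall x y, out_le r' (msum (fE f) (fO f) x) (msum (fE f) (fO f) y) =
               out_le r x y).

Definition sum_rel (A A' : Type) (R : rel A) (R' : rel A') : rel (A + A') :=
  fun x y =>
    match x, y with
    | inl a, inl b => R a b
    | inr a, inr b => R' a b
    | _, _ => false
    end.

Lemma fibre_order_pre (A A' : Type) (B : eqType) (h : A -> B) (R : rel A)
    (g : A' -> A) :
  injective g -> fibre_order h R -> fibre_order (h \o g) (relpre g R).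
Proof.
move=> g_inj [Rxx Ranti Rtr Rtot]; split=> [x|x y|y x z|x y] /=.
- exact: Rxx.
- by move/Ranti/g_inj.
- exact: Rtr.
- exact: Rtot.
Qed.

Lemma fibre_order_sum (A A' : Type) (B B' : eqType) (h : A -> B) (h' : A' -> B')
    (R : rel A) (R' : rel A') :
  fibre_order h R -> fibre_order h' R' ->
  fibre_order (msum h h' : _ -> B + B')%type (sum_rel R R').
Proof.
move=> [Rxx Ra Rt Rtot] [Rxx' Ra' Rt' Rtot'].
split=> [[x|x]|[x|x] [y|y]|[y|y] [x|x] [z|z]|[x|x] [y|y]] //=.
- by move/Ra->.
- by move/Ra'->.
- exact: Rt.
- exact: Rt'.
Qed.

Lemma fibre_order_empty (A : Type) (B : eqType) (h : A -> B) (R : rel A) :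
  (A -> False) -> fibre_order h R.
Proof. by move=> A0; split=> x; case: (A0 x). Qed.

Lemma void_sum_empty : void + void -> False.
Proof. by case=> -[]. Qed.

Definition corolla_cat k l k' l' (G : graph k l) (H : graph k' l')
    (r : corolla_order G) (r' : corolla_order H) : corolla_order (graph_cat G H) :=
  @CorollaOrder _ _ (graph_cat G H)
    (relpre (@sumACA _ _ _ _) (sum_rel (in_le r) (in_le r')))
    (relpre (@sumACA _ _ _ _) (sum_rel (out_le r) (out_le r')))
    (fibre_order_pre (bij_inj (sumACA_bij _ _ _ _))
       (fibre_order_sum (in_leP r) (in_leP r')))
    (fibre_order_pre (bij_inj (sumACA_bij _ _ _ _))
       (fibre_order_sum (out_leP r) (out_leP r'))).

Definition corolla_join k l (G : graph k.+1 l.+1)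
    (e : gI G + gIO G) (f : gO G + gIO G) (r : corolla_order G) :
    corolla_order (graph_join e f) :=
  @CorollaOrder _ _ (graph_join e f)
    (relpre (end_in (join e f)) (in_le r))
    (relpre (end_out (join e f)) (out_le r))
    (fibre_order_pre (bij_inj (end_in_bij e f)) (in_leP r))
    (fibre_order_pre (bij_inj (end_out_bij e f)) (out_leP r)).

Definition corolla_structure : graph_structure :=
  @GraphStructure corolla_order corolla_iso
    (fun k l s G r =>
       @CorollaOrder _ _ (graph_lact s G) _ _ (in_leP r) (out_leP r))
    (fun k l G s r =>
       @CorollaOrder _ _ (graph_ract G s) _ _ (in_leP r) (out_leP r))
    corolla_cat
    (@CorollaOrder _ _ graph_empty (fun _ _ => true) (fun _ _ => true)
       (fibre_order_empty _ _ void_sum_empty) (fibre_order_empty _ _ void_sum_empty))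
    (@CorollaOrder _ _ graph_wire (fun _ _ => true) (fun _ _ => true)
       (fibre_order_empty _ _ void_sum_empty) (fibre_order_empty _ _ void_sum_empty))
    corolla_join.

(** ** Decorations *)

Section Decorations.
Variable X : nat -> nat -> Type.

Definition decoration k l (G : graph k l) : Type :=
  forall v : gV G, X (indeg v) (outdeg v).

Definition decoration_at k l (G : graph k l) (d : decoration G) (v : gV G) :
    {n : nat * nat & X n.1 n.2} :=
  existT (fun n => X n.1 n.2) (indeg v, outdeg v) (d v).

Definition decoration_iso k l (G H : graph k l) (f : giso G H)
    (d : decoration G) (d' : decoration H) : Prop :=
  forall v, decoration_at d' (fV f v) = decoration_at d v.

Lemma card_fibre_bij (A A' : finType) (B : eqType) (h : A -> B) (g : A' -> A)
    (b : B) :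
  bijective g -> #|[pred x | h x == b]| = #|[pred x | h (g x) == b]|.
Proof.
by move=> g_bij; rewrite -(on_card_preimset (onW_bij _ g_bij)) !cardsE.
Qed.

Lemma card_fibre_suml (A A' : finType) (B B' : finType) (h : A -> B)
    (h' : A' -> B') (b : B) :
  #|[pred x | h x == b]| = #|[pred x | msum h h' x == inl b]|.
Proof.
have inl_inj' : injective (@inl A A') by move=> x y [].
rewrite -(card_image inl_inj'); apply: eq_card => -[x|x].
  by rewrite (mem_image inl_inj') !inE.
by rewrite !inE; apply/negbTE/imageP => -[].
Qed.

Lemma card_fibre_sumr (A A' : finType) (B B' : finType) (h : A -> B)
    (h' : A' -> B') (b : B') :
  #|[pred x | h' x == b]| = #|[pred x | msum h h' x == inr b]|.
Proof.
have inr_inj' : injective (@inr A A') by move=> x y [].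
rewrite -(card_image inr_inj'); apply: eq_card => -[x|x].
  by rewrite !inE; apply/negbTE/imageP => -[].
by rewrite (mem_image inr_inj') !inE.
Qed.

Section DecCat.
Variables (k l k' l' : nat) (G : graph k l) (H : graph k' l').

Lemma indeg_catl (v : gV G) : indeg v = @indeg _ _ (graph_cat G H) (inl v).
Proof.
by rewrite /indeg /= (card_fibre_suml _ (tgt H)) (card_fibre_bij _ _ (sumACA_bij _ _ _ _)).
Qed.

Lemma outdeg_catl (v : gV G) : outdeg v = @outdeg _ _ (graph_cat G H) (inl v).
Proof.
by rewrite /outdeg /= (card_fibre_suml _ (src H)) (card_fibre_bij _ _ (sumACA_bij _ _ _ _)).
Qed.

Lemma indeg_catr (v : gV H) : indeg v = @indeg _ _ (graph_cat G H) (inr v).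
Proof.
by rewrite /indeg /= (card_fibre_sumr (tgt G)) (card_fibre_bij _ _ (sumACA_bij _ _ _ _)).
Qed.

Lemma outdeg_catr (v : gV H) : outdeg v = @outdeg _ _ (graph_cat G H) (inr v).
Proof.
by rewrite /outdeg /= (card_fibre_sumr (src G)) (card_fibre_bij _ _ (sumACA_bij _ _ _ _)).
Qed.

Definition decoration_cat (d : decoration G) (d' : decoration H) :
    decoration (graph_cat G H) :=
  fun v => match v with
           | inl v => cast2 (indeg_catl v) (outdeg_catl v) (d v)
           | inr v => cast2 (indeg_catr v) (outdeg_catr v) (d' v)
           end.

End DecCat.

Section DecJoin.
Variables (k l : nat) (G : graph k.+1 l.+1).
Variables (e : gI G + gIO G) (f : gO G + gIO G).

Lemma indeg_join (v : gV G) : indeg v = @indeg _ _ (graph_join e f) v.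
Proof. exact: card_fibre_bij (end_in_bij e f). Qed.

Lemma outdeg_join (v : gV G) : outdeg v = @outdeg _ _ (graph_join e f) v.
Proof. exact: card_fibre_bij (end_out_bij e f). Qed.

Definition decoration_join (d : decoration G) : decoration (graph_join e f) :=
  fun v => cast2 (indeg_join v) (outdeg_join v) (d v).

End DecJoin.

Definition decoration_structure : graph_structure :=
  @GraphStructure decoration decoration_iso
    (fun k l s G d => d) (fun k l G s d => d)
    decoration_cat
    (fun v => match v with end) (fun v => match v with end)
    decoration_join.

End Decorations.

(** * Isomorphism classes *)

Definition sgraph (S : graph_structure) (k l : nat) : Type :=
  {G : graph k l & S k l G}.

Definition sgraph_iso (S : graph_structure) k l (G H : sgraph S k l) : Prop :=
  exists f : giso (projT1 G) (projT1 H), gs_iso f (projT2 G) (projT2 H).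

Definition sgraph_ops (S : graph_structure) : trap_ops (sgraph S) :=
  @TrapOps (sgraph S)
    (fun k l s G => existT _ _ (gs_lact S s (projT2 G)))
    (fun k l G s => existT _ _ (gs_ract S s (projT2 G)))
    (fun k l k' l' G H => existT _ _ (gs_cat S (projT2 G) (projT2 H)))
    (existT _ _ (gs_empty S))
    (fun k l i j G => existT _ (graph_ptr i j (projT1 G))
       (gs_join S _ _ (projT2 G))).

Definition sgraph_wire (S : graph_structure) : sgraph S 1 1 :=
  existT _ _ (gs_wire S).

(* The quotient of A by the relation R, as the set of its classes. *)
Definition quotient (A : Type) (R : A -> A -> Prop) : Type :=
  {C : A -> Prop | exists x, C = R x}.

Definition class_of (A : Type) (R : A -> A -> Prop) (x : A) : quotient R :=
  exist _ (R x) (ex_intro _ x erefl).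

Definition iso_classes (S : graph_structure) (k l : nat) : Type :=
  quotient (@sgraph_iso S k l).

Definition iso_class (S : graph_structure) k l (G : sgraph S k l) :
    iso_classes S k l :=
  class_of (@sgraph_iso S k l) G.

Definition Gr : nat -> nat -> Type := iso_classes no_structure.
Definition CGr : nat -> nat -> Type := iso_classes corolla_structure.
Definition GrX (X : nat -> nat -> Type) : nat -> nat -> Type :=
  iso_classes (decoration_structure X).
Definition CGrX (X : nat -> nat -> Type) : nat -> nat -> Type :=
  iso_classes (pair_structure corolla_structure (decoration_structure X)).

(* The operations T on isomorphism classes are those induced by the operations
   on graphs; this determines T. *)
Record induced_ops (S : graph_structure) (T : trap_ops (iso_classes S)) : Prop :=
  InducedOps {
  induced_lact : forall k l (s : 'S_l) (G : sgraph S k l),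
    lact T s (iso_class G) = iso_class (lact (sgraph_ops S) s G);
  induced_ract : forall k l (s : 'S_k) (G : sgraph S k l),
    ract T (iso_class G) s = iso_class (ract (sgraph_ops S) G s);
  induced_hcat : forall k l k' l' (G : sgraph S k l) (H : sgraph S k' l'),
    hcat T (iso_class G) (iso_class H) = iso_class (hcat (sgraph_ops S) G H);
  induced_hone : hone T = iso_class (hone (sgraph_ops S));
  induced_ptr : forall k l (i : 'I_k.+1) (j : 'I_l.+1) (G : sgraph S k.+1 l.+1),
    ptr T i j (iso_class G) = iso_class (ptr (sgraph_ops S) i j G)
}.

(* Main.v *)
Require Import Defs.
From mathcomp Require Import all_boot all_fingroup.
From mathcomp Require Import zify boolp.
(* After the group library, whose [ract] would otherwise hide the right action
   of [trap_ops]. *)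
Import Defs.

Set Implicit Arguments.
Unset Strict Implicit.
Unset Printing Implicit Defensive.

(** An edge of any of the four kinds E, I, O, IO starts either at a vertex or at
    an input label, and ends either at a vertex or at an output label.  So a
    graph is the same thing as
    - a set V of vertices, a set In of places where an edge can enter a vertex
      (here E + I) with its map to V, and a set Out of places where an edge can
      leave a vertex (here E + O) with its map to V;
    - a one-to-one correspondence from Out + {inputs} to In + {outputs}, which
      says how the starts of edges are linked to their ends;
    - a number of loops.
    In this encoding, a [wiring], the four kinds of edges are no longer told
    apart, and the operations become uniform.  A permutation relabels the
    correspondence and a disjoint union is a sum.  The partial trace t_(i,j)
    keeps V, In and Out, and links a to b if a was linked to b, or if a was
    linked to the output j and the input i was linked to b; one loop is added if
    i was linked to j.  Corolla orders are relations on In and on Out, and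
    decorations are a function on V, so all of these are untouched by traces and
    permutations.

    The axioms of a unitary TRAP then become statements about Boolean relations
    and labels.  The interchange of two traces (four axioms, which would need an
    analysis of the kinds of up to four edges) is [wptr_wptr]: the
    links of both sides are the same Boolean combination of links before the
    traces, and the two counts of loops agree because no end is linked to two
    starts.

    The translation rests on two facts.  Two graphs are isomorphic exactly when
    their wirings are ([wiso_of_sgraph_iso], [sgraph_iso_of_wiso]), and the
    wiring of the result of each operation is the operation applied to wirings;
    the case that matters is the trace, [join_wired] and [join_loops].  The
    wirings of isomorphic graphs being isomorphic, the operations pass to
    isomorphism classes, and every axiom is checked on wirings.  The four kinds
    of graphs are treated at once through [local_structure], which says that the
    structure is encoded by a relation on In, a relation on Out and a function
    on V, compatibly with the operations. *)

(** * Permutations acting on labels *)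

(** Labels of wirings are bare natural numbers, so that the casts along
    k + 0 = k or k + k' = k' + k in the axioms disappear.  Outside the range
    of s the value is the label itself, so that this is a group action. *)
Definition nperm n (s : 'S_n) (i : nat) : nat :=
  if insub i is Some o then val (s o) else i.

Lemma npermE n (s : 'S_n) (i : 'I_n) : nperm s i = s i.
Proof. by rewrite /nperm valK. Qed.

Lemma nperm_lt n (s : 'S_n) i : i < n -> nperm s i < n.
Proof. by move=> lt_i; rewrite (npermE s (Ordinal lt_i)). Qed.

Lemma nperm1 n i : nperm (1 : 'S_n)%g i = i.
Proof. by rewrite /nperm; case: insubP => // o _ <-; rewrite perm1. Qed.

Lemma npermM n (s t : 'S_n) i : nperm (s * t)%g i = nperm t (nperm s i).
Proof.
rewrite {1 3}/nperm; case: insubP => [o _ _|ni]; first by rewrite npermE permM.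
by rewrite /nperm insubN.
Qed.

Lemma npermK n (s : 'S_n) : cancel (nperm s) (nperm s^-1).
Proof. by move=> i; rewrite -npermM mulgV nperm1. Qed.

Lemma npermKV n (s : 'S_n) : cancel (nperm s^-1) (nperm s).
Proof. by move=> i; rewrite -npermM mulVg nperm1. Qed.

Lemma nperm_tensor m n (s : 'S_m) (t : 'S_n) i : i < m + n ->
  nperm (tensor_perm s t) i =
  if i < m then nperm s i else m + nperm t (i - m).
Proof.
move=> lt_i; rewrite -[i in LHS]/(val (Ordinal lt_i)) npermE permE /tensor_fun.
case: splitP => o /= ->; first by rewrite ltn_ord npermE.
by rewrite ltnNge leq_addr addKn npermE.
Qed.

Lemma nperm_swap m n i : i < m + n ->
  nperm (swap_perm m n) i = if i < m then n + i else i - m.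
Proof.
move=> lt_i; rewrite -[i in LHS]/(val (Ordinal lt_i)) npermE permE /swap_fun.
by case: splitP => o /= ->; rewrite ?ltn_ord // ltnNge leq_addr addKn.
Qed.

Lemma nperm_cycle n a b i : b < n -> i < n ->
  nperm (cycle_perm n a b) i =
  if a <= i <= b then if i == b then a else i.+1 else i.
Proof.
move=> lt_b lt_i; rewrite -[i in LHS]/(val (Ordinal lt_i)) npermE permE /=.
by rewrite lt_b.
Qed.

(** The form in which [perm_del] meets a trace: deleting a letter and inserting
    the deleted position back are related by [bump]. *)
Lemma nperm_del n (s : 'S_n.+1) (q : 'I_n.+1) i : i < n ->
  nperm s (bump (s^-1%g q) i) = bump q (nperm (perm_del s q) i).
Proof.
move=> lt_i; rewrite -[i in RHS]/(val (Ordinal lt_i)) npermE [perm_del _ _ _]permE.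
rewrite -[RHS]/(val (lift q (perm_del_fun s q (Ordinal lt_i)))).
by rewrite lift_unlift_ne -[RHS]npermE.
Qed.

Lemma nperm_delV n (s : 'S_n.+1) (q : 'I_n.+1) i : i < n ->
  nperm s^-1 (bump q i) = bump (s^-1%g q) (nperm (perm_del s q)^-1 i).
Proof.
move=> lt_i; apply: (can_inj (npermK s)); rewrite npermKV nperm_del ?nperm_lt //.
by rewrite npermKV.
Qed.

(** * Wirings *)

Definition below (A : Type) k (a : A + nat) : bool :=
  if a is inr i then i < k else true.

(** [wlink a b] means that an edge starts at a and ends at b, a number standing
    for an input label on the left and for an output label on the right.
    [wle_in], [wle_out] and [wval] hold the additional structure.  The numbers
    of inputs and outputs are not part of the data: a wiring is only meaningful
    on the labels below the bounds given to [wiso]. *)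
Record wiring (U : Type) := Wiring {
  wV : Type;
  wIn : Type;
  wOut : Type;
  wtgt : wIn -> wV;
  wsrc : wOut -> wV;
  wle_in : rel wIn;
  wle_out : rel wOut;
  wval : wV -> U;
  wlink : wOut + nat -> wIn + nat -> bool;
  wloops : nat
}.

Section Wirings.
Variable U : Type.
Implicit Types D : wiring U.

Record wiring_iso k l D D' (fv : wV D -> wV D') (fi : wIn D -> wIn D')
    (fo : wOut D -> wOut D') : Prop := WiringIso {
  mor_tgt : forall a, wtgt (fi a) = fv (wtgt a);
  mor_src : forall a, wsrc (fo a) = fv (wsrc a);
  mor_le_in : forall a b, wle_in (fi a) (fi b) = wle_in a b;
  mor_le_out : forall a b, wle_out (fo a) (fo b) = wle_out a b;
  mor_val : forall v, wval (fv v) = wval v;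
  mor_link : forall a b, below k a -> below l b ->
    wlink (msum fo id a) (msum fi id b) = wlink a b;
  mor_loops : wloops D' = wloops D
}.

Definition wiso k l D D' : Prop :=
  exists fv fi fo, [/\ bijective fv, bijective fi, bijective fo
                     & @wiring_iso k l D D' fv fi fo].

Lemma msum_id (A B : Type) (a : A + B) : msum id id a = a.
Proof. by case: a. Qed.

Lemma below_msum (A B : Type) k (f : A -> B) (a : A + nat) :
  below k (msum f id a) = below k a.
Proof. by case: a. Qed.

Lemma msum_comm (A B : Type) (f : A -> B) (g : nat -> nat) (a : A + nat) :
  msum f id (msum id g a) = msum id g (msum f id a).
Proof. by case: a. Qed.

Lemma wiso_refl k l D : wiso k l D D.
Proof.
by exists id, id, id; split; try exact: inv_bij; split=> // a b _ _; rewrite !msum_id.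
Qed.

Lemma wiso_sym k l D D' : wiso k l D D' -> wiso k l D' D.
Proof.
case=> fv [fi [fo [[gv fvK gvK] [gi fiK giK] [go foK goK] [mt ms mi mo ma mr ml]]]].
exists gv, gi, go; split; try by [exists fv | exists fi | exists fo].
split=> //.
- by move=> a; rewrite -{2}[a]giK mt fvK.
- by move=> a; rewrite -{2}[a]goK ms fvK.
- by move=> a b; rewrite -mi !giK.
- by move=> a b; rewrite -mo !goK.
- by move=> v; rewrite -ma gvK.
- move=> a b ka lb; rewrite -mr ?below_msum //.
  by case: a b {ka lb} => [a|a] [b|b] /=; rewrite ?goK ?giK.
Qed.

Lemma wiso_trans k l D D' D'' :
  wiso k l D D' -> wiso k l D' D'' -> wiso k l D D''.
Proof.
case=> fv [fi [fo [bv bi bo [mt ms mi mo ma mr ml]]]].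
case=> fv' [fi' [fo' [bv' bi' bo' [mt' ms' mi' mo' ma' mr' ml']]]].
exists (fv' \o fv), (fi' \o fi), (fo' \o fo).
split; try exact: bij_comp.
split=> [a|a|a b|a b|v|a b ka lb|] /=.
- by rewrite mt' mt.
- by rewrite ms' ms.
- by rewrite mi'.
- by rewrite mo'.
- by rewrite ma'.
- rewrite -mr // -mr' ?below_msum //.
  by case: a b {ka lb} => [a|a] [b|b].
- by rewrite ml'.
Qed.

(** Permutations and traces change nothing but the links and the loops, so
    that their axioms are equalities of relations, with identity maps as
    isomorphisms ([wiso_rewire]). *)
Definition rewire D (w : wOut D + nat -> wIn D + nat -> bool) (n : nat) : wiring U :=
  Wiring (@wtgt U D) (@wsrc U D) (@wle_in U D) (@wle_out U D) (@wval U D) w n.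

Lemma wiso_rewire k l D w w' n n' :
  (forall a b, below k a -> below l b -> w a b = w' a b) -> n = n' ->
  wiso k l (@rewire D w n) (@rewire D w' n').
Proof.
move=> eqw ->; exists id, id, id; split; try exact: inv_bij.
by split=> // a b ka lb; rewrite /= eqw // !msum_id.
Qed.

Lemma wiso_rewire_self k l D w n :
  (forall a b, below k a -> below l b -> w a b = wlink a b) -> n = wloops D ->
  wiso k l (@rewire D w n) D.
Proof.
move=> eqw ->; exists id, id, id; split; try exact: inv_bij.
by split=> // a b ka lb; rewrite /= eqw // !msum_id.
Qed.

(** * Operations on wirings *)

Definition wlact l (s : 'S_l) D : wiring U :=
  @rewire D (fun a b => wlink a (msum id (nperm s^-1) b)) (wloops D).

Definition wract k D (s : 'S_k) : wiring U :=
  @rewire D (fun a b => wlink (msum id (nperm s) a) b) (wloops D).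

(** The summand of a disjoint union, with k labels on the left, in which an end
    of an edge lies, with its label there. *)
Definition side (A A' : Type) k (a : (A + A') + nat) : (A + nat) + (A' + nat) :=
  match a with
  | inl (inl x) => inl (inl x)
  | inl (inr x) => inr (inl x)
  | inr i => if i < k then inl (inr i) else inr (inr (i - k))
  end.

Definition sum_link (A A' B B' : Type) (R : A -> B -> bool) (R' : A' -> B' -> bool)
    (a : A + A') (b : B + B') : bool :=
  match a, b with
  | inl a, inl b => R a b
  | inr a, inr b => R' a b
  | _, _ => false
  end.

Definition wcat k l D D' : wiring U :=
  Wiring (msum (@wtgt U D) (@wtgt U D')) (msum (@wsrc U D) (@wsrc U D'))
    (sum_rel (@wle_in U D) (@wle_in U D')) (sum_rel (@wle_out U D) (@wle_out U D'))
    (fun v => match v with inl v => wval v | inr v => wval v end)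
    (fun a b => sum_link (@wlink U D) (@wlink U D') (side k a) (side l b))
    (wloops D + wloops D').

Definition wempty : wiring U :=
  @Wiring U void void void id id (fun _ _ => true) (fun _ _ => true)
    (of_void U) (fun _ _ => false) 0.

Definition wwire : wiring U :=
  @Wiring U void void void id id (fun _ _ => true) (fun _ _ => true)
    (of_void U)
    (fun a b => if (a, b) is (inr i, inr j) then (i == 0) && (j == 0) else false) 0.

(** [bump] renames the labels that survive into the original ones. *)
Definition wptr i j D : wiring U :=
  @rewire D (fun a b => let a' := msum id (bump i) a in let b' := msum id (bump j) b in
                wlink a' b' || wlink a' (inr j) && wlink (inr i) b')
    (wloops D + wlink (inr i : wOut D + nat) (inr j : wIn D + nat)).

Lemma below_nperm (A : Type) k (s : 'S_k) (a : A + nat) :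
  below k a -> below k (msum id (nperm s) a).
Proof. by case: a => //= i; apply: nperm_lt. Qed.

Lemma bump_lt k i x : x < k -> bump i x < k.+1.
Proof. rewrite /bump; lia. Qed.

Lemma below_bump (A : Type) k i (a : A + nat) :
  below k a -> below k.+1 (msum id (bump i) a).
Proof. by case: a => //= x; exact: bump_lt. Qed.

Lemma wlact_congr k l (s : 'S_l) D D' :
  wiso k l D D' -> wiso k l (wlact s D) (wlact s D').
Proof.
case=> fv [fi [fo [bv bi bo [mt ms mi mo ma mr ml]]]].
exists fv, fi, fo; split=> //; split=> // a b ka lb /=.
by rewrite -msum_comm mr // below_nperm.
Qed.

Lemma wract_congr k l D D' (s : 'S_k) :
  wiso k l D D' -> wiso k l (wract D s) (wract D' s).
Proof.
case=> fv [fi [fo [bv bi bo [mt ms mi mo ma mr ml]]]].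
exists fv, fi, fo; split=> //; split=> // a b ka lb /=.
by rewrite -msum_comm mr // below_nperm.
Qed.

Lemma wptr_congr k l i j D D' : i < k.+1 -> j < l.+1 ->
  wiso k.+1 l.+1 D D' -> wiso k l (wptr i j D) (wptr i j D').
Proof.
move=> lti ltj [fv [fi [fo [bv bi bo [mt ms mi mo ma mr ml]]]]].
exists fv, fi, fo; split=> //; split=> //= [a b ka lb|].
  have [ka' lb'] := (below_bump i ka, below_bump j lb).
  by rewrite -!msum_comm -(mr _ (inr j)) // -(mr (inr i)) // mr.
by rewrite -(mr (inr i) (inr j)) // ml.
Qed.

Lemma side_msum (A A' B B' : Type) k (f : A -> B) (f' : A' -> B') a :
  side k (msum (msum f f') id a) = msum (msum f id) (msum f' id) (side k a).
Proof. by case: a => [[a|a]|i] //=; case: ifP. Qed.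

Lemma side_below (A A' : Type) k k' (a : (A + A') + nat) :
  below (k + k') a ->
  match side k a with inl x => below k x | inr x => below k' x end.
Proof. by case: a => [[a|a]|i] //=; case: ifP => //= ?; lia. Qed.

Lemma wcat_congr k l k' l' D D' E E' :
  wiso k l D E -> wiso k' l' D' E' ->
  wiso (k + k') (l + l') (wcat k l D D') (wcat k l E E').
Proof.
case=> fv [fi [fo [bv bi bo [mt ms mi mo ma mr ml]]]].
case=> gv [gi [go [bv' bi' bo' [mt' ms' mi' mo' ma' mr' ml']]]].
exists (msum fv gv), (msum fi gi), (msum fo go); split; try exact: msum_bij.
split=> /=.
- by case=> a /=; rewrite ?mt ?mt'.
- by case=> a /=; rewrite ?ms ?ms'.
- by case=> a [b|b] /=; rewrite ?mi ?mi'.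
- by case=> a [b|b] /=; rewrite ?mo ?mo'.
- by case.
- move=> a b ka lb; rewrite !side_msum.
  move: (side_below ka) (side_below lb).
  by case: (side k a) (side l b) => a' [b'|b'] /=; [exact: mr|..|exact: mr'].
- by rewrite ml ml'.
Qed.

(** * The axioms on wirings *)

Lemma wlact1 k l D : wiso k l (wlact (1 : 'S_l) D) D.
Proof.
apply: wiso_rewire_self => // a [b|b] _ _ //=.
by rewrite invg1 nperm1.
Qed.

Lemma wlactM k l (s t : 'S_l) D :
  wiso k l (wlact s (wlact t D)) (wlact (t * s)%g D).
Proof.
apply: wiso_rewire => // a [b|b] _ _ //=.
by rewrite invMg npermM.
Qed.

Lemma wract1 k l D : wiso k l (wract D (1 : 'S_k)) D.
Proof. by apply: wiso_rewire_self => // [[a|a]] b _ _ //=; rewrite nperm1. Qed.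

Lemma wractM k l (s t : 'S_k) D :
  wiso k l (wract (wract D s) t) (wract D (t * s)%g).
Proof. by apply: wiso_rewire => // [[a|a]] b _ _ //=; rewrite npermM. Qed.

Definition sum_assoc (A B C : Type) (x : A + (B + C)) : (A + B) + C :=
  match x with
  | inl a => inl (inl a)
  | inr (inl b) => inl (inr b)
  | inr (inr c) => inr c
  end.

Lemma sum_assoc_bij (A B C : Type) : bijective (@sum_assoc A B C).
Proof.
exists (fun x => match x with
                 | inl (inl a) => inl a
                 | inl (inr b) => inr (inl b)
                 | inr c => inr (inr c)
                 end).
  by case=> [|[]].
by case=> [[]|].
Qed.

Lemma wcatA k l k' l' k'' l'' D D' D'' :
  wiso (k + (k' + k'')) (l + (l' + l''))
    (wcat k l D (wcat k' l' D' D''))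
    (wcat (k + k') (l + l') (wcat k l D D') D'').
Proof.
exists (@sum_assoc _ _ _), (@sum_assoc _ _ _), (@sum_assoc _ _ _).
split; try exact: sum_assoc_bij.
split=> /=.
- by case=> [a|[a|a]].
- by case=> [a|[a|a]].
- by case=> [a|[a|a]] [b|[b|b]].
- by case=> [a|[a|a]] [b|[b|b]].
- by case=> [a|[a|a]].
- move=> a b _ _.
  by case: a b => [[a|[a|a]]|a] [[b|[b|b]]|b] //=;
    repeat (case: ifP => ? //=); rewrite ?subnDA //; lia.
- by rewrite addnA.
Qed.

Lemma inl_bij (A : Type) : bijective (@inl A void).
Proof.
exists (fun x : A + void => match x with inl a => a | inr v => of_void _ v end).
  by [].
by case=> [|[]].
Qed.

Lemma inr_bij (A : Type) : bijective (@inr void A).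
Proof.
exists (fun x : void + A => match x with inr a => a | inl v => of_void _ v end).
  by [].
by case=> [[]|].
Qed.

Lemma wcat1w k l D : wiso k l (wcat 0 0 wempty D) D.
Proof.
apply: wiso_sym; exists inr, inr, inr; split; try exact: inr_bij.
by split=> // -[a|a] [b|b] _ _ //=; rewrite ?subn0.
Qed.

Lemma wcatw1 k l D : wiso (k + 0) (l + 0) (wcat k l D wempty) D.
Proof.
rewrite !addn0; apply: wiso_sym; exists inl, inl, inl; split; try exact: inl_bij.
by split=> //= [[a|a] [b|b] /= ka lb|]; rewrite ?ka ?lb //= addn0.
Qed.

(** The two summands of a disjoint union keep to themselves under
    [tensor_perm], and are exchanged by [swap_perm] ([side_swap]). *)
Lemma side_tensor (A A' : Type) m n (s : 'S_m) (t : 'S_n) (a : (A + A') + nat) :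
  below (m + n) a ->
  side m (msum id (nperm (tensor_perm s t)) a) =
  msum (msum id (nperm s)) (msum id (nperm t)) (side m a).
Proof.
case: a => [[a|a]|i] //= lt_i; rewrite nperm_tensor //.
case: (ltnP i m) => lt_im /=; first by rewrite nperm_lt.
by rewrite ltnNge leq_addr addKn.
Qed.

Lemma tensor_permV m n (s : 'S_m) (t : 'S_n) :
  ((tensor_perm s t)^-1 = tensor_perm s^-1 t^-1)%g.
Proof.
apply/permP => x; apply: (@perm_inj _ (tensor_perm s t)); rewrite permKV !permE.
rewrite -{1}(splitK x) /tensor_fun; case: (split x) => o.
  by rewrite (unsplitK (inl _)) permKV.
by rewrite (unsplitK (inr _)) permKV.
Qed.

Lemma wcat_act k l k' l' (s : 'S_l) D (t : 'S_k) (s' : 'S_l') D' (t' : 'S_k') :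
  wiso (k + k') (l + l')
    (wcat k l (wract (wlact s D) t) (wract (wlact s' D') t'))
    (wract (wlact (tensor_perm s s') (wcat k l D D')) (tensor_perm t t')).
Proof.
apply: (@wiso_rewire _ _ (wcat k l D D')) => //= a b ka lb.
rewrite tensor_permV !side_tensor //.
by case: (side k a) (side l b) => a' [].
Qed.

Definition swap_sum (A B : Type) (x : A + B) : B + A :=
  match x with inl a => inr a | inr b => inl b end.

Lemma swap_sum_bij (A B : Type) : bijective (@swap_sum A B).
Proof. by exists (@swap_sum B A); case. Qed.

Lemma side_swap (A A' : Type) m n (a : (A + A') + nat) :
  below (m + n) a ->
  side n (msum (@swap_sum _ _) (nperm (swap_perm m n)) a) = swap_sum (side m a).
Proof.
case: a => [[a|a]|i] //= lt_i; rewrite nperm_swap //.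
case: (ltnP i m) => lt_im /=; first by rewrite ltnNge leq_addr addKn.
by rewrite ifT //; lia.
Qed.

(** Lets an action be moved across an isomorphism, where the inverse
    permutation that defines it cancels. *)
Lemma wlactV k l (s : 'S_l) D D' :
  wiso k l D (wlact s^-1 D') -> wiso k l (wlact s D) D'.
Proof.
move/(wlact_congr s)/wiso_trans; apply; apply: wiso_trans (wlactM _ _ _ _) _.
rewrite mulVg; exact: wlact1.
Qed.

Lemma wractV k l D D' (s : 'S_k) :
  wiso k l D (wract D' s) -> wiso k l (wract D s^-1) D'.
Proof.
move/(wract_congr s^-1)/wiso_trans; apply; apply: wiso_trans (wractM _ _ _ _) _.
rewrite mulVg; exact: wract1.
Qed.

Lemma wcatC k l k' l' D D' :
  wiso (k + k') (l + l') (wlact (swap_perm l l') (wcat k l D D'))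
    (wract (wcat k' l' D' D) (swap_perm k k')).
Proof.
apply: wlactV.
exists (@swap_sum _ _), (@swap_sum _ _), (@swap_sum _ _).
split; try exact: swap_sum_bij.
split=> /=; try by [case | case=> a []].
- move=> a b ka lb; rewrite invgK.
  have swap_then (A B : Type) g (c : (A + B) + nat) :
      msum id g (msum (@swap_sum _ _) id c) = msum (@swap_sum _ _) g c by case: c.
  by rewrite !swap_then !side_swap //; case: (side k a) (side l b) => a' [].
- exact: addnC.
Qed.

(** The labels that remain once i and then i' are removed do not depend on the
    order of the two removals. *)
Lemma bump_exchange i i' i1 i2 : i2 = bump i i' -> i = bump i2 i1 ->
  forall x, bump i (bump i' x) = bump i2 (bump i1 x).
Proof. by rewrite /bump; lia. Qed.

(** The two removed pairs of labels are (i, j) and (i2, j2), numbered as in D.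
    A link of the result, in either order, is a path through D which may pass
    through each of the two joints; going twice through the same joint gives
    nothing new.  A new loop can go through one joint or through both, and in
    the latter case neither joint closes alone, because no end of D is linked to
    two starts. *)
Lemma wptr_wptr k l D i j i' j' i1 j1 i2 j2 :
  (forall a a' (b : wIn D + nat), wlink a b -> wlink a' b -> a = a') ->
  i2 = bump i i' -> i = bump i2 i1 -> j2 = bump j j' -> j = bump j2 j1 ->
  wiso k l (wptr i' j' (wptr i j D)) (wptr i1 j1 (wptr i2 j2 D)).
Proof.
move=> winj ei ei' ej ej'.
have xi := bump_exchange ei ei'; have xj := bump_exchange ej ej'.
have ni : i2 != i by rewrite ei eq_sym neq_bump.
have nj : j2 != j by rewrite ej eq_sym neq_bump.
apply: wiso_rewire => [a b _ _|] /=; rewrite -ei -ej -ei' -ej'.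
  have ->: msum id (bump i) (msum id (bump i') a) =
      msum id (bump i2) (msum id (bump i1) a).
    by case: a => //= a; rewrite xi.
  have ->: msum id (bump j) (msum id (bump j') b) =
      msum id (bump j2) (msum id (bump j1) b).
    by case: b => //= b; rewrite xj.
  move: (msum _ _ (msum _ _ a)) (msum _ _ (msum _ _ b)) => a' b'.
  by do ![case: (wlink _ _) => //=].
rewrite -!addnA; congr (_ + _).
(* The only discrepancies left have two starts linked to one end. *)
case wij: (wlink (inr i) (inr j)); case wij2: (wlink (inr i2) (inr j2));
case w2: (wlink (inr i2) (inr j)); case w3: (wlink (inr i) (inr j2)) => //=.
all: by [move: (winj _ _ _ wij w2) => -[e]; rewrite e eqxx in ni |
         move: (winj _ _ _ wij2 w3) => -[e]; rewrite e eqxx in ni ].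
Qed.

Lemma wptr_act k l (s : 'S_l.+1) D (t : 'S_k.+1) (i : 'I_k.+1) (j : 'I_l.+1) :
  wiso k l (wptr i j (wract (wlact s D) t))
    (wract (wlact (perm_del s j) (wptr (t i) (s^-1%g j) D)) (perm_del t (t i))).
Proof.
apply: wiso_rewire => [a b ka lb|] /=; rewrite !npermE //.
have ->: msum id (nperm t) (msum id (bump i) a) =
    msum id (bump (t i)) (msum id (nperm (perm_del t (t i))) a).
  by case: a ka => //= x ltx; rewrite -nperm_del // permK.
have ->// : msum id (nperm s^-1) (msum id (bump j) b) =
    msum id (bump (s^-1%g j)) (msum id (nperm (perm_del s j)^-1) b).
by case: b lb => //= x ltx; rewrite -nperm_delV.
Qed.

Lemma side_bumpl (A A' : Type) k i (a : (A + A') + nat) : i <= k ->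
  side k.+1 (msum id (bump i) a) = msum (msum id (bump i)) id (side k a).
Proof.
move=> le_ik; case: a => [[a|a]|x] //=.
have -> : (bump i x < k.+1) = (x < k) by rewrite /bump; lia.
case: (ltnP x k) => //= le_kx.
by have -> : bump i x - k.+1 = x - k by rewrite /bump; lia.
Qed.

Lemma side_bumpr (A A' : Type) k i (a : (A + A') + nat) :
  side k (msum id (bump (k + i)) a) = msum id (msum id (bump i)) (side k a).
Proof.
case: a => [[a|a]|x] //=.
have -> : (bump (k + i) x < k) = (x < k) by rewrite /bump; lia.
case: (ltnP x k) => /= [lt_xk|le_kx].
  by have -> : bump (k + i) x = x by rewrite /bump; lia.
by have -> : bump (k + i) x - k = bump i (x - k) by rewrite /bump; lia.
Qed.

Lemma wptr_catl k l k' l' D D' i j : i <= k -> j <= l ->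
  wiso (k + k') (l + l') (wptr i j (wcat k.+1 l.+1 D D'))
    (wcat k l (wptr i j D) D').
Proof.
move=> le_i le_j; apply: wiso_rewire => [a b _ _|] /=;
  last by rewrite !ltnS le_i le_j addnAC.
rewrite !side_bumpl //= !ltnS le_i le_j.
by case: (side k a) (side l b) => a' [b'|b'] //=; rewrite ?orbF ?andbF.
Qed.

Lemma wptr_catr k l k' l' D D' i j :
  wiso (k + k') (l + l') (wptr (k + i) (l + j) (wcat k l D D'))
    (wcat k l D (wptr i j D')).
Proof.
apply: wiso_rewire => [a b _ _|] /=.
  rewrite !side_bumpr ![_ + _ < _]ltnNge !leq_addr !addKn /=.
  by case: (side k a) (side l b) => a' [b'|b'] //=; rewrite ?orbF ?andbF.
by rewrite ![_ + _ < _]ltnNge !leq_addr !addKn /= addnA.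
Qed.

(** Joining the output j of D to the wire moves that end to the output label of
    the wire, which is the first one; the removal of j then shifts the labels
    in between, whence the cycle.  The three lemmas that follow are the same
    with inputs for outputs, or with the wire on the right. *)
Lemma wptr_unitl_out k l D j : 0 < j <= l ->
  wiso k l (wptr 0 j (wcat 1 1 wwire D)) (wlact (cycle_perm l 0 j.-1) D).
Proof.
move=> lt_j; apply/wiso_sym/wlactV.
exists inr, inr, inr; split; try exact: inr_bij.
split=> //= [a b ka lb|]; last by rewrite (ltnNge j 1) (andP lt_j).1 addn0.
have sa : side 1 (msum id (bump 0) (msum inr id a)) = inr a.
  by case: a {ka} => //= i; rewrite addKn.
rewrite sa; case: b lb => [b|b] /= lb; first by rewrite andbF orbF.
rewrite invgK nperm_cycle //; last lia.
have [eb|nb] := eqVneq b j.-1.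
  have -> : bump j (if 0 <= b <= j.-1 then 0 else b) = 0.
    by rewrite /bump; case: ifP; lia.
  by rewrite /= andbT (ltnNge j 1) (andP lt_j).1 /= subn1 eb.
have -> : bump j (if 0 <= b <= j.-1 then b.+1 else b) = b.+1.
  by rewrite /bump; case: ifP; lia.
by rewrite /= subn1 andbF orbF.
Qed.

Lemma wptr_unitl_in k l D i : 0 < i <= k ->
  wiso k l (wptr i 0 (wcat 1 1 wwire D)) (wract D (cycle_perm k 0 i.-1)^-1).
Proof.
move=> lt_i; apply/wiso_sym/wractV.
exists inr, inr, inr; split; try exact: inr_bij.
split=> //= [a b ka lb|]; last by rewrite (ltnNge i 1) (andP lt_i).1 addn0.
have sb : side 1 (msum id (bump 0) (msum inr id b)) = inr b.
  by case: b {lb} => //= j; rewrite addKn.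
rewrite sb; case: a ka => [a|a] /= ka; first by rewrite orbF.
rewrite nperm_cycle //; last lia.
have [ea|na] := eqVneq a i.-1.
  have -> : bump i (if 0 <= a <= i.-1 then 0 else a) = 0.
    by rewrite /bump; case: ifP; lia.
  by rewrite /= (ltnNge i 1) (andP lt_i).1 /= subn1 ea.
have -> : bump i (if 0 <= a <= i.-1 then a.+1 else a) = a.+1.
  by rewrite /bump; case: ifP; lia.
by rewrite /= subn1 orbF.
Qed.

Lemma wptr_unitr_out k l D j : j < l ->
  wiso k l (wptr k j (wcat k l D wwire)) (wlact (cycle_perm l j l.-1)^-1 D).
Proof.
move=> lt_j; apply/wiso_sym; exists inl, inl, inl; split; try exact: inl_bij.
split=> //= [a b ka lb|]; last by rewrite lt_j ltnn !addn0.
have sa : side k (msum id (bump k) (msum inl id a)) = inl a.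
  case: a ka => //= i lt_i; have -> : bump k i = i by rewrite /bump; lia.
  by rewrite lt_i.
rewrite sa invgK; case: b lb => [b|b] /= lb; first by rewrite ltnn subnn andbF orbF.
rewrite lt_j ltnn subnn nperm_cycle //; last lia.
have [eb|nb] := eqVneq b l.-1.
  have -> : bump j b = l by rewrite /bump; lia.
  by rewrite ltnn subnn ifT ?andbT //; lia.
have -> : bump j b = if j <= b <= l.-1 then b.+1 else b.
  by rewrite /bump; case: ifP; lia.
have lt_c : (if j <= b <= l.-1 then b.+1 else b) < l by case: ifP; lia.
by rewrite lt_c andbF orbF.
Qed.

Lemma wptr_unitr_in k l D i : i < k ->
  wiso k l (wptr i l (wcat k l D wwire)) (wract D (cycle_perm k i k.-1)).
Proof.
move=> lt_i; apply/wiso_sym; exists inl, inl, inl; split; try exact: inl_bij.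
split=> //= [a b ka lb|]; last by rewrite lt_i ltnn !addn0.
have sb : side l (msum id (bump l) (msum inl id b)) = inl b.
  case: b lb => //= j lt_j; have -> : bump l j = j by rewrite /bump; lia.
  by rewrite lt_j.
rewrite sb; case: a ka => [a|a] /= ka; first by rewrite ltnn orbF.
rewrite lt_i ltnn subnn nperm_cycle //; last lia.
have [ea|na] := eqVneq a k.-1.
  have -> : bump i a = k by rewrite /bump; lia.
  by rewrite ltnn subnn ifT //; lia.
have -> : bump i a = if i <= a <= k.-1 then a.+1 else a.
  by rewrite /bump; case: ifP; lia.
have lt_c : (if i <= a <= k.-1 then a.+1 else a) < k by case: ifP; lia.
by rewrite lt_c orbF.
Qed.

End Wirings.

(** * Links in a graph *)

Section Wires.
Variables (k l : nat) (G : graph k l).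

(** One constructor for each kind of edge, listing its start and its end. *)
Inductive wire : (gE G + gO G) + nat -> (gE G + gI G) + nat -> Prop :=
| WireE e : wire (inl (inl e)) (inl (inl e))
| WireI e : wire (inr (val (alpha G (inl e)))) (inl (inr e))
| WireO e : wire (inl (inr e)) (inr (val (beta G (inl e))))
| WireIO e : wire (inr (val (alpha G (inr e)))) (inr (val (beta G (inr e)))).

Definition wired (a : (gE G + gO G) + nat) (b : (gE G + gI G) + nat) : bool :=
  match a, b with
  | inl (inl e), inl (inl e') => e == e'
  | inr i, inl (inr e) => i == alpha G (inl e)
  | inl (inr e), inr j => j == beta G (inl e)
  | inr i, inr j => [exists e, (i == alpha G (inr e)) && (j == beta G (inr e))]
  | _, _ => false
  end.

Lemma wiredP a b : reflect (wire a b) (wired a b).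
Proof.
apply: (iffP idP) => [|[e|e|e|e] /=]; rewrite ?eqxx //; last first.
  by apply/existsP; exists e; rewrite !eqxx.
case: a b => [[e|e]|i] [[e'|e']|j] //=.
- by move/eqP->; exact: WireE.
- by move/eqP->; exact: WireO.
- by move/eqP->; exact: WireI.
- by case/existsP=> e /andP[/eqP-> /eqP->]; exact: WireIO.
Qed.

Lemma wired_fun a b b' : wired a b -> wired a b' -> b = b'.
Proof.
have inj_a := bij_inj (alpha_bij G).
case: a b b' => [[e|e]|i] [[x|x]|x] [[y|y]|y] //=.
- by move=> /eqP<- /eqP->.
- by move=> /eqP-> /eqP->.
- by move=> /eqP-> /eqP/val_inj/inj_a[->].
- by move=> /eqP-> /existsP[z /andP[/eqP/val_inj/inj_a]].
- by move=> /existsP[z /andP[/eqP-> _]] /eqP/val_inj/inj_a.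
- move=> /existsP[z /andP[/eqP-> /eqP->]] /existsP[w /andP[]].
  by move=> /eqP/val_inj/inj_a[->] /eqP->.
Qed.

Lemma wired_inj a a' b : wired a b -> wired a' b -> a = a'.
Proof.
have inj_b := bij_inj (beta_bij G).
case: b a a' => [[e|e]|i] [[x|x]|x] [[y|y]|y] //=.
- by move=> /eqP-> /eqP->.
- by move=> /eqP-> /eqP->.
- by move=> /eqP-> /eqP/val_inj/inj_b[->].
- by move=> /eqP-> /existsP[z /andP[_ /eqP/val_inj/inj_b]].
- by move=> /existsP[z /andP[_ /eqP->]] /eqP/val_inj/inj_b.
- move=> /existsP[z /andP[/eqP-> /eqP->]] /existsP[w /andP[]] /eqP->.
  by move=> /eqP/val_inj/inj_b[->].
Qed.

Lemma wired_total a : below k a -> exists2 b, below l b & wire a b.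
Proof.
have [g gK Kg] := alpha_bij G.
case: a => [[e|e]|i] /= lt_i.
- by exists (inl (inl e)) => //; exact: WireE.
- by exists (inr (val (beta G (inl e)))); [exact: ltn_ord | exact: WireO].
- rewrite -[i]/(val (Ordinal lt_i)) -(Kg (Ordinal lt_i)).
  case: (g _) => e; first by exists (inl (inr e)) => //; exact: WireI.
  by exists (inr (val (beta G (inr e)))); [exact: ltn_ord | exact: WireIO].
Qed.

(** As every start is linked to some end, a relation in which a start has at
    most one end is equal to [wired] as soon as it contains the edges.  This
    reduces the comparison of the links of two graphs to one case for each edge
    of one of them. *)
Lemma wired_eq (R : (gE G + gO G) + nat -> (gE G + gI G) + nat -> bool) :
  (forall a b, wire a b -> R a b) ->
  (forall a b b', R a b -> R a b' -> b = b') ->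
  forall a b, below k a -> below l b -> R a b = wired a b.
Proof.
move=> incl funR a b ka lb; apply/idP/idP => [Rab|/wiredP/incl //].
have [b' lb' wab'] := wired_total ka.
by rewrite (funR a b b') //; [exact/wiredP | exact: incl].
Qed.

End Wires.

Arguments wire {k l}.
Arguments wired {k l}.

Lemma giso_wired k l (G H : graph k l) (f : giso G H) a b :
  below k a -> below l b ->
  wired H (msum (msum (fE f) (fO f)) id a) (msum (msum (fE f) (fI f)) id b) =
  wired G a b.
Proof.
move: a b; apply: wired_eq => [a b w|a b b' w w'].
  apply/wiredP; case: w => e /=; first exact: WireE.
  - by rewrite -(giso_alpha f); exact: WireI.
  - by rewrite -(giso_beta f); exact: WireO.
  - by rewrite -(giso_alpha f) -(giso_beta f); exact: WireIO.
apply: (bij_inj (msum_bij (msum_bij (fE_bij f) (fI_bij f)) (inv_bij (fun=> erefl)))).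
exact: wired_fun w w'.
Qed.

Lemma side_inj (A A' : Type) k : injective (@side A A' k).
Proof.
case=> [[x|x]|x] [[y|y]|y] //=; do ?case: ifP => ?; move=> // -[] // exy;
  try by rewrite exy.
by congr (inr _); lia.
Qed.

Lemma cat_wired k l k' l' (G : graph k l) (H : graph k' l') a b :
  below (k + k') a -> below (l + l') b ->
  sum_link (wired G) (wired H) (side k (msum (@sumACA _ _ _ _) id a))
    (side l (msum (@sumACA _ _ _ _) id b)) = wired (graph_cat G H) a b.
Proof.
move: a b.
pose R a b := sum_link (wired G) (wired H) (side k (msum (@sumACA _ _ _ _) id a))
    (side l (msum (@sumACA _ _ _ _) id b)).
apply: (@wired_eq _ _ (graph_cat G H) R) => [a b|a b b1]; rewrite /R.
  case=> e; case: e => e /=; rewrite ?eqxx ?ltn_ord //=.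
  - by rewrite ltnNge leq_addr addKn /= eqxx.
  - by rewrite ltnNge leq_addr addKn /= eqxx.
  - by apply/existsP; exists e; rewrite !eqxx.
  - rewrite !(ltnNge (_ + _)) !leq_addr !addKn /=.
    by apply/existsP; exists e; rewrite !eqxx.
have inj_cat : injective (msum (@sumACA (gE G) (gE H) (gI G) (gI H)) (@id nat)).
  exact: bij_inj (msum_bij (sumACA_bij _ _ _ _) (inv_bij (fun=> erefl))).
move=> Rab Rab'; apply: inj_cat; apply: (@side_inj _ _ l); move: Rab Rab'.
case: (side k _) => [x|x]; case: (side l _) => [y|y]; case: (side l _) => [z|z] //= w w'.
  by rewrite (wired_fun w w').
by rewrite (wired_fun w w').
Qed.

Arguments wired {k l} G a b : simpl never.

Section JoinWires.
Variables (k l : nat) (G : graph k.+1 l.+1).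
Variables (e : gI G + gIO G) (f : gO G + gIO G).

Lemma bump_join_alpha x :
  bump (alpha G e) (join_alpha (e:=e) (f:=f) x) = alpha G (lab_in (join e f) x).
Proof. by rewrite -[LHS]/(val (lift (alpha G e) (join_alpha x))) lift_unlift_ne. Qed.

Lemma bump_join_beta x :
  bump (beta G f) (join_beta (e:=e) (f:=f) x) = beta G (lab_out (join e f) x).
Proof. by rewrite -[LHS]/(val (lift (beta G f) (join_beta x))) lift_unlift_ne. Qed.

(** The links prescribed by [wptr], in terms of the labels of G. *)
Definition traced a b :=
  wired G a b || wired G a (inr (val (beta G f))) && wired G (inr (val (alpha G e))) b.

(** An old edge is a link of G.  The new edge is the two-step path through the
    joint, in each of the cases where it is not a loop. *)
Lemma join_traced a b : wire (graph_join e f) a b ->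
  traced (msum (end_out (join e f)) (bump (alpha G e)) a)
         (msum (end_in (join e f)) (bump (beta G f)) b).
Proof.
case=> x /=; rewrite ?bump_join_alpha ?bump_join_beta; move: x;
  rewrite /traced; case: e f => e1 [f1|f1] /=; try (case: ifP => _ /=);
  try (by move=> x; apply/orP; left; apply/wiredP; constructor);
  case=> [x|]; apply/orP;
  by [left; apply/wiredP; constructor
     | right; apply/andP; split; apply/wiredP; constructor].
Qed.

Lemma traced_fun a b b' :
  traced (msum (end_out (join e f)) (bump (alpha G e)) a)
         (msum (end_in (join e f)) (bump (beta G f)) b) ->
  traced (msum (end_out (join e f)) (bump (alpha G e)) a)
         (msum (end_in (join e f)) (bump (beta G f)) b') -> b = b'.
Proof.
have inj_b : injective (msum (end_in (join e f)) (bump (beta G f))).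
  case=> x [] y //= [exy]; first by rewrite (bij_inj (end_in_bij e f) exy).
  by rewrite (can_inj (bumpK _) exy).
have nb x : inr (val (beta G f)) <> msum (end_in (join e f)) (bump (beta G f)) x.
  by case: x => //= x [e_x]; move: (neq_bump (beta G f) x); rewrite -e_x eqxx.
rewrite /traced => /orP[w|/andP[w v]] /orP[w'|/andP[w' v']]; apply: inj_b.
- exact: wired_fun w w'.
- by case/nb: (wired_fun w' w).
- by case/nb: (wired_fun w w').
- exact: wired_fun v v'.
Qed.

Lemma join_wired a b : below k a -> below l b ->
  traced (msum (end_out (join e f)) (bump (alpha G e)) a)
         (msum (end_in (join e f)) (bump (beta G f)) b) =
  wired (graph_join e f) a b.
Proof.
move: a b.
pose R a b := traced (msum (end_out (join e f)) (bump (alpha G e)) a)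
         (msum (end_in (join e f)) (bump (beta G f)) b).
apply: (@wired_eq _ _ (graph_join e f) R) => [a b|a b b'].
  exact: join_traced.
exact: traced_fun.
Qed.

(** The new edge is a loop exactly when e and f are the same input-output edge,
    that is when its input label is linked to its output label. *)
Lemma join_loops : #|gL (graph_join e f)| =
  #|gL G| + wired G (inr (val (alpha G e))) (inr (val (beta G f))).
Proof.
have inj_a := bij_inj (alpha_bij G); have inj_b := bij_inj (beta_bij G).
have -> : wired G (inr (val (alpha G e))) (inr (val (beta G f))) =
    match e, f with inr x, inr y => x == y | _, _ => false end.
  apply/existsP/idP => [[x /andP[/eqP/val_inj/inj_a-> /eqP/val_inj/inj_b->]]|] //.
  by case: e f => [//|x] [//|y] /eqP<-; exists x; rewrite !eqxx.
rewrite /=; case: e f => e1 [f1|f1] /=; rewrite ?addn0 //.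
by case: eqP => _ /=; rewrite ?addn0 // card_option addn1.
Qed.

End JoinWires.

(** * Structures encoded on half-edges and vertices *)

(** What a graph structure must satisfy to be carried along by wirings: it is
    encoded by relations on the entering and on the leaving half-edges and by
    values at the vertices, and the operations transport this encoding along
    the maps of half-edges that they induce. *)
Record local_structure (S : graph_structure) := LocalStructure {
  loc_val : Type;
  loc_in : forall k l (G : graph k l), S k l G -> rel (gE G + gI G);
  loc_out : forall k l (G : graph k l), S k l G -> rel (gE G + gO G);
  loc_at : forall k l (G : graph k l), S k l G -> gV G -> loc_val;
  loc_iso : forall k l (G H : graph k l) (f : giso G H) (x : S k l G) (y : S k l H),
    gs_iso f x y <->
    [/\ forall a b, loc_in y (msum (fE f) (fI f) a) (msum (fE f) (fI f) b) = loc_in x a b,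
        forall a b, loc_out y (msum (fE f) (fO f) a) (msum (fE f) (fO f) b) = loc_out x a b
      & forall v, loc_at y (fV f v) = loc_at x v];
  loc_lact : forall k l (s : 'S_l) (G : graph k l) (x : S k l G),
    [/\ loc_in (gs_lact S s x) =2 loc_in x,
        loc_out (gs_lact S s x) =2 loc_out x
      & loc_at (gs_lact S s x) =1 loc_at x];
  loc_ract : forall k l (G : graph k l) (s : 'S_k) (x : S k l G),
    [/\ loc_in (gs_ract S s x) =2 loc_in x,
        loc_out (gs_ract S s x) =2 loc_out x
      & loc_at (gs_ract S s x) =1 loc_at x];
  loc_cat : forall k l k' l' (G : graph k l) (H : graph k' l')
      (x : S k l G) (y : S k' l' H),
    [/\ loc_in (gs_cat S x y) =2 relpre (@sumACA _ _ _ _) (sum_rel (loc_in x) (loc_in y)),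
        loc_out (gs_cat S x y) =2 relpre (@sumACA _ _ _ _) (sum_rel (loc_out x) (loc_out y))
      & forall v, loc_at (gs_cat S x y) v =
          match v with inl v => loc_at x v | inr v => loc_at y v end];
  loc_join : forall k l (G : graph k.+1 l.+1) (e : gI G + gIO G) (f : gO G + gIO G)
      (x : S k.+1 l.+1 G),
    [/\ loc_in (gs_join S e f x) =2 relpre (end_in (join e f)) (loc_in x),
        loc_out (gs_join S e f x) =2 relpre (end_out (join e f)) (loc_out x)
      & loc_at (gs_join S e f x) =1 loc_at x]
}.

Lemma sum_rel_false (A B : Type) (x y : A + B) :
  sum_rel (fun _ _ => false) (fun _ _ => false) x y = false.
Proof. by case: x y => a []. Qed.

Lemma no_structure_local : local_structure no_structure.
Proof.
apply: (@LocalStructure no_structure unit (fun _ _ _ _ _ _ => false)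
  (fun _ _ _ _ _ _ => false) (fun _ _ _ _ _ => tt)) => //.
- move=> k l k' l' G H x y.
  by split=> [a b|a b|[]] //=; rewrite sum_rel_false.
Qed.

Lemma corolla_structure_local : local_structure corolla_structure.
Proof.
apply: (@LocalStructure corolla_structure unit (fun k l G r => in_le r)
  (fun k l G r => out_le r) (fun _ _ _ _ _ => tt)) => //.
- by move=> k l G H f r r'; split=> [[]|[]].
- by move=> k l k' l' G H r r'; split=> // -[].
Qed.

Section DecorationLocal.
Variable X : nat -> nat -> Type.

(** Transporting a decoration along equalities of degrees does not change it as
    a decoration together with its degrees. *)
Lemma existT_cast2 m n m' n' (em : m = m') (en : n = n') (x : X m n) :
  existT (fun n => X n.1 n.2) (m', n') (cast2 em en x) =
  existT (fun n => X n.1 n.2) (m, n) x.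
Proof. by case: m' / em; case: n' / en. Qed.

Lemma decoration_at_cat k l k' l' (G : graph k l) (H : graph k' l')
    (d : decoration X G) (d' : decoration X H) (v : gV (graph_cat G H)) :
  decoration_at (decoration_cat d d') v =
  match v with inl v => decoration_at d v | inr v => decoration_at d' v end.
Proof. by case: v => v; exact: existT_cast2. Qed.

Lemma decoration_at_join k l (G : graph k.+1 l.+1)
    (e : gI G + gIO G) (f : gO G + gIO G) (d : decoration X G) :
  decoration_at (@decoration_join X k l G e f d) =1 decoration_at d.
Proof. by move=> v; exact: existT_cast2. Qed.

Lemma decoration_structure_local : local_structure (decoration_structure X).
Proof.
apply: (@LocalStructure (decoration_structure X) _ (fun _ _ _ _ _ _ => false)
  (fun _ _ _ _ _ _ => false) (@decoration_at X)) => //=.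
- by move=> k l G H f d d'; split=> [|[]].
- move=> k l k' l' G H d d'; split=> [a b|a b|v] /=; rewrite ?sum_rel_false //.
  exact: decoration_at_cat.
- by move=> k l G e f d; split=> //; exact: decoration_at_join.
Qed.

Lemma corolla_decoration_structure_local :
  local_structure (pair_structure corolla_structure (decoration_structure X)).
Proof.
apply: (@LocalStructure (pair_structure corolla_structure (decoration_structure X)) _
  (fun k l G x => in_le x.1) (fun k l G x => out_le x.1)
  (fun k l G x => decoration_at x.2)) => //=.
- by move=> k l G H f x y; split=> [[[]]|[]].
- by move=> k l k' l' G H x y; split=> // v; exact: decoration_at_cat.
- by move=> k l G e f d; split=> //; exact: decoration_at_join.
Qed.

End DecorationLocal.

(** * Graphs and their wirings *)

Section Presentation.
Variables (S : graph_structure) (L : local_structure S).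

Definition wiring_of k l (G : sgraph S k l) : wiring (loc_val L) :=
  Wiring (tgt (projT1 G)) (src (projT1 G)) (loc_in L (projT2 G))
    (loc_out L (projT2 G)) (loc_at L (projT2 G)) (wired (projT1 G)) #|gL (projT1 G)|.

Lemma wiso_of_sgraph_iso k l (G H : sgraph S k l) :
  sgraph_iso G H -> wiso k l (wiring_of G) (wiring_of H).
Proof.
case: G H => G x [H y] [f /(loc_iso L)[/= f_in f_out f_at]].
exists (fV f), (msum (fE f) (fI f)), (msum (fE f) (fO f)).
split; try exact: fV_bij.
- exact: msum_bij (fE_bij f) (fI_bij f).
- exact: msum_bij (fE_bij f) (fO_bij f).
split=> //=; [exact: giso_tgt | exact: giso_src | exact: giso_wired | ].
by rewrite (bij_eq_card (fL_bij f)).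
Qed.

(** The kind of an edge can be read off from its start and its end, so that maps
    of half-edges which preserve links split into maps on the four kinds. *)
Lemma edge_maps k l (G H : graph k l)
    (fi : gE G + gI G -> gE H + gI H) (fo : gE G + gO G -> gE H + gO H) :
  injective fi -> injective fo ->
  (forall a b, below k a -> below l b ->
     wired H (msum fo id a) (msum fi id b) = wired G a b) ->
  exists fE fI fO fIO, [/\ [/\ injective fE, injective fI, injective fO & injective fIO],
    msum fE fI =1 fi, msum fE fO =1 fo,
    (forall x, alpha H (msum fI fIO x) = alpha G x)
    & (forall x, beta H (msum fO fIO x) = beta G x)].
Proof.
move=> inj_fi inj_fo eq_w.
have hE e : exists e', fi (inl e) = inl e' /\ fo (inl e) = inl e'.
  have := eq_w (inl (inl e)) (inl (inl e)) isT isT; rewrite {2}/wired eqxx /=.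
  by case: (fo _) (fi _) => [x|x] [y|y] // /eqP->; exists y.
have hI e : exists e', fi (inr e) = inr e' /\ alpha H (inl e') = alpha G (inl e).
  have := eq_w (inr (val (alpha G (inl e)))) (inl (inr e)) (ltn_ord _) isT.
  rewrite {2}/wired eqxx /=.
  by case: (fi _) => [y|y] // /eqP/val_inj; exists y.
have hO e : exists e', fo (inr e) = inr e' /\ beta H (inl e') = beta G (inl e).
  have := eq_w (inl (inr e)) (inr (val (beta G (inl e)))) isT (ltn_ord _).
  rewrite {2}/wired eqxx /=.
  by case: (fo _) => [y|y] // /eqP/val_inj; exists y.
have hIO e : exists e', alpha H (inr e') = alpha G (inr e) /\
    beta H (inr e') = beta G (inr e).
  have := eq_w (inr (val (alpha G (inr e)))) (inr (val (beta G (inr e))))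
    (ltn_ord _) (ltn_ord _).
  have -> : wired G (inr (val (alpha G (inr e)))) (inr (val (beta G (inr e)))).
    by apply/wiredP; constructor.
  by case/existsP => e' /andP[/eqP/val_inj ea /eqP/val_inj eb]; exists e'.
have [fE fEP] := choice hE; have [fI fIP] := choice hI.
have [fO fOP] := choice hO; have [fIO fIOP] := choice hIO.
exists fE, fI, fO, fIO; split.
- split=> x y exy.
  + by have [+ _] := fEP x; have [+ _] := fEP y; rewrite exy => <- /inj_fi[].
  + by have [+ _] := fIP x; have [+ _] := fIP y; rewrite exy => <- /inj_fi[].
  + by have [+ _] := fOP x; have [+ _] := fOP y; rewrite exy => <- /inj_fo[].
  + have [+ _] := fIOP x; have [+ _] := fIOP y; rewrite exy => ->.
    by move/(bij_inj (alpha_bij G)) => [].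
- by case=> e /=; [have [] := fEP e | have [] := fIP e].
- by case=> e /=; [have [] := fEP e | have [] := fOP e].
- by case=> e /=; [have [] := fIP e | have [] := fIOP e].
- by case=> e /=; [have [] := fOP e | have [] := fIOP e].
Qed.

Lemma eq_card_bij (A B : finType) : #|A| = #|B| -> exists f : A -> B, bijective f.
Proof.
move=> eAB; exists (fun x => enum_val (cast_ord eAB (enum_rank x))).
exists (fun y => enum_val (cast_ord (esym eAB) (enum_rank y))) => x.
  by rewrite enum_valK cast_ordK enum_rankK.
by rewrite enum_valK cast_ordKV enum_rankK.
Qed.

Lemma sgraph_iso_of_wiso k l (G H : sgraph S k l) :
  wiso k l (wiring_of G) (wiring_of H) -> sgraph_iso G H.
Proof.
case: G H => G x [H y] iGH.
have [_ [gi [go [_ gi_bij go_bij [_ _ _ _ _ mr' _]]]] /=] := wiso_sym iGH.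
have [hE [hI [hO [hIO [[hE_inj hI_inj hO_inj hIO_inj] _ _ _ _]]]]] :=
  edge_maps (bij_inj gi_bij) (bij_inj go_bij) mr'.
case: iGH => fv [fi [fo [bv bi bo [mt ms mi mo ma mr ml]]]].
have [fE [fI [fO [fIO [[fE_inj fI_inj fO_inj fIO_inj] e_fi e_fo e_a e_b]]]]] :=
  edge_maps (bij_inj bi) (bij_inj bo) mr.
have [fL fL_bij] := eq_card_bij (esym ml).
(* The inverse isomorphism provides injections in the other direction, so the
   maps between edges of each kind are bijective by counting. *)
have bE := inj_card_bij fE_inj (leq_card _ hE_inj).
have bI := inj_card_bij fI_inj (leq_card _ hI_inj).
have bO := inj_card_bij fO_inj (leq_card _ hO_inj).
have bIO := inj_card_bij fIO_inj (leq_card _ hIO_inj).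
have f_src a : src H (msum fE fO a) = fv (src G a) by rewrite e_fo; exact: ms.
have f_tgt a : tgt H (msum fE fI a) = fv (tgt G a) by rewrite e_fi; exact: mt.
exists (GIso bv bE bI bO bIO fL_bij f_src f_tgt e_a e_b).
apply/(loc_iso L); split=> [a b|a b|v] /=; last exact: ma.
  by rewrite !e_fi; exact: mi.
by rewrite !e_fo; exact: mo.
Qed.

Lemma wiring_of_lact k l (s : 'S_l) (G : sgraph S k l) :
  wiso k l (wiring_of (lact (sgraph_ops S) s G)) (wlact s (wiring_of G)).
Proof.
case: G => G x; have [e_in e_out e_at] := loc_lact L s x.
exists id, id, id; split; try exact: inv_bij.
split=> //= a b ka lb; rewrite !msum_id.
move: a b ka lb; pose R a b := wired G a (msum id (nperm s^-1) b).
apply: (@wired_eq _ _ (graph_lact s G) R) => [a b|a b b']; rewrite /R.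
  move=> w; apply/wiredP; case: w => e /=; try by constructor.
    by rewrite npermE permK; constructor.
  by rewrite npermE permK; constructor.
move=> w /(wired_fun w); case: b b' {w} => [b|b] [b'|b'] //= [].
by move/(can_inj (npermKV s))->.
Qed.

Lemma wiring_of_ract k l (G : sgraph S k l) (s : 'S_k) :
  wiso k l (wiring_of (ract (sgraph_ops S) G s)) (wract (wiring_of G) s).
Proof.
case: G => G x; have [e_in e_out e_at] := loc_ract L s x.
exists id, id, id; split; try exact: inv_bij.
split=> //= a b ka lb; rewrite !msum_id.
move: a b ka lb; pose R a b := wired G (msum id (nperm s) a) b.
apply: (@wired_eq _ _ (graph_ract G s) R) => [a b|a b b']; rewrite /R.
  move=> w; apply/wiredP; case: w => e /=; try by constructor.
    by rewrite npermE permKV; constructor.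
  by rewrite npermE permKV; constructor.
exact: wired_fun.
Qed.

Lemma wiring_of_hcat k l k' l' (G : sgraph S k l) (H : sgraph S k' l') :
  wiso (k + k') (l + l') (wiring_of (hcat (sgraph_ops S) G H))
    (wcat k l (wiring_of G) (wiring_of H)).
Proof.
case: G H => G x [H y]; have [e_in e_out e_at] := loc_cat L x y.
exists id, (@sumACA _ _ _ _), (@sumACA _ _ _ _).
split; try exact: sumACA_bij; first exact: inv_bij.
split=> //=; first exact: cat_wired.
by rewrite card_sum.
Qed.

Definition void_merge (x : void + void) : void :=
  match x with inl y | inr y => y end.

Lemma void_merge_bij : bijective void_merge.
Proof. by exists inl => [[[]|[]]|[]]. Qed.

Lemma wiring_of_hone : wiso 0 0 (wiring_of (hone (sgraph_ops S))) (wempty (loc_val L)).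
Proof.
exists id, void_merge, void_merge.
split; try exact: void_merge_bij; first exact: inv_bij.
split; try by case=> -[].
by rewrite /= card_void.
Qed.

Lemma wiring_of_wire : wiso 1 1 (wiring_of (sgraph_wire S)) (wwire (loc_val L)).
Proof.
exists id, void_merge, void_merge.
split; try exact: void_merge_bij; first exact: inv_bij.
split; try by case=> -[].
- case=> [[[]|[]]|i] [[[]|[]]|j] //=; rewrite !ltnS !leqn0 => /eqP-> /eqP->.
  by apply/esym/existsP; exists tt.
- by rewrite /= card_void.
Qed.

Lemma preim_ofK (A : choiceType) (B : eqType) (h : A -> B) (h_bij : bijective h) y :
  h (preim_of h_bij y) = y.
Proof. by apply/eqP; exact: (xchooseP (bij_surj h_bij y)). Qed.

Lemma wiring_of_ptr k l (i : 'I_k.+1) (j : 'I_l.+1) (G : sgraph S k.+1 l.+1) :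
  wiso k l (wiring_of (ptr (sgraph_ops S) i j G)) (wptr i j (wiring_of G)).
Proof.
case: G => G x /=; rewrite /graph_ptr.
set e := preim_of (alpha_bij G) i; set f := preim_of (beta_bij G) j.
have [e_in e_out e_at] := loc_join L e f x.
exists id, (end_in (join e f)), (end_out (join e f)).
split; [exact: inv_bij | exact: end_in_bij | exact: end_out_bij | split=> //=].
- move=> a b ka lb; rewrite -(join_wired ka lb) /traced.
  rewrite !preim_ofK.
  by case: a b {ka lb} => [a|a] [b|b].
- by rewrite join_loops !preim_ofK.
Qed.

End Presentation.

(** * Operations on isomorphism classes *)

Section Quotient.
Variables (S : graph_structure) (L : local_structure S).

Lemma iso_class_eq k l (G H : sgraph S k l) :
  wiso k l (wiring_of L G) (wiring_of L H) -> iso_class G = iso_class H.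
Proof.
move=> iGH.
have eGH : sgraph_iso G = sgraph_iso H.
  apply/funext => K; apply/propext; split=> /(wiso_of_sgraph_iso L) iK.
    exact/(sgraph_iso_of_wiso (L := L))/(wiso_trans (wiso_sym iGH)).
  exact/(sgraph_iso_of_wiso (L := L))/(wiso_trans iGH).
rewrite /iso_class /class_of; move: (ex_intro _ G _) (ex_intro _ H _).
by rewrite eGH => p q; congr (exist _ _ _); exact: Prop_irrelevance.
Qed.

Lemma iso_class_inv k l (G H : sgraph S k l) :
  iso_class G = iso_class H -> wiso k l (wiring_of L G) (wiring_of L H).
Proof.
move/(congr1 (@proj1_sig _ _)) => /= eGH; apply: wiso_of_sgraph_iso.
by rewrite eGH; apply: (@sgraph_iso_of_wiso _ L); exact: wiso_refl.
Qed.

Lemma iso_class_surj k l (c : iso_classes S k l) : exists G, c = iso_class G.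
Proof.
case: c => C hC; have [G eC] := hC; exists G; subst C.
by congr (exist _ _ _); exact: Prop_irrelevance.
Qed.

(** Representatives are chosen; [class_ops_induced] shows that the choice does
    not matter. *)
Definition repr k l (c : iso_classes S k l) : sgraph S k l :=
  projT1 (cid (iso_class_surj c)).

Lemma reprK k l (c : iso_classes S k l) : iso_class (repr c) = c.
Proof. by rewrite /repr; case: cid => G /= ->. Qed.

Definition class_ops : trap_ops (iso_classes S) :=
  @TrapOps (iso_classes S)
    (fun k l s p => iso_class (lact (sgraph_ops S) s (repr p)))
    (fun k l p s => iso_class (ract (sgraph_ops S) (repr p) s))
    (fun k l k' l' p q => iso_class (hcat (sgraph_ops S) (repr p) (repr q)))
    (iso_class (hone (sgraph_ops S)))
    (fun k l i j p => iso_class (ptr (sgraph_ops S) i j (repr p))).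

Local Notation T := class_ops.

(** All axioms are transported through this relation: the operations send
    presented classes to presented classes, and wirings determine classes
    ([presented_inj]). *)
Definition presented k l (p : iso_classes S k l) (D : wiring (loc_val L)) : Prop :=
  wiso k l (wiring_of L (repr p)) D.

Lemma presented_class k l (G : sgraph S k l) D :
  wiso k l (wiring_of L G) D -> presented (iso_class G) D.
Proof. by apply: wiso_trans; apply: iso_class_inv; exact: reprK. Qed.

Lemma presented_inj k l (p q : iso_classes S k l) D E :
  presented p D -> presented q E -> wiso k l D E -> p = q.
Proof.
move=> pD qE iDE; rewrite -(reprK p) -(reprK q); apply: iso_class_eq.
exact: wiso_trans pD (wiso_trans iDE (wiso_sym qE)).
Qed.

Lemma presented_repr k l (p : iso_classes S k l) : presented p (wiring_of L (repr p)).
Proof. exact: wiso_refl. Qed.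

Lemma presented_cast k l k' l' (ek : k = k') (el : l = l') (p : iso_classes S k l) D :
  presented p D -> presented (cast2 ek el p) D.
Proof. by case: k' / ek; case: l' / el. Qed.

Lemma presented_lact k l (s : 'S_l) (p : iso_classes S k l) D :
  presented p D -> presented (lact T s p) (wlact s D).
Proof.
move=> pD; apply/presented_class/(wiso_trans (wiring_of_lact _ _ _)).
exact: wlact_congr.
Qed.

Lemma presented_ract k l (p : iso_classes S k l) (s : 'S_k) D :
  presented p D -> presented (ract T p s) (wract D s).
Proof.
move=> pD; apply/presented_class/(wiso_trans (wiring_of_ract _ _ _)).
exact: wract_congr.
Qed.

Lemma presented_hcat k l k' l' (p : iso_classes S k l) (q : iso_classes S k' l') D E :
  presented p D -> presented q E -> presented (hcat T p q) (wcat k l D E).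
Proof.
move=> pD qE; apply/presented_class/(wiso_trans (wiring_of_hcat _ _ _)).
exact: wcat_congr.
Qed.

(** The shapes in which an axiom feeds a concatenation to a trace, whose arity
    has to be a successor on the nose. *)
Lemma presented_hcatS k l k' l' (p : iso_classes S k.+1 l.+1) (q : iso_classes S k' l') D E :
  presented p D -> presented q E ->
  @presented (k + k').+1 (l + l').+1 (hcat T p q) (wcat k.+1 l.+1 D E).
Proof. exact: presented_hcat. Qed.

Lemma presented_hcat1 k l (p : iso_classes S 1 1) (q : iso_classes S k l) D E :
  presented p D -> presented q E ->
  @presented k.+1 l.+1 (hcat T p q) (wcat 1 1 D E).
Proof. exact: presented_hcat. Qed.

Lemma presented_hone : presented (hone T) (wempty (loc_val L)).
Proof. exact/presented_class/wiring_of_hone. Qed.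

Lemma presented_wire : presented (iso_class (sgraph_wire S)) (wwire (loc_val L)).
Proof. exact/presented_class/wiring_of_wire. Qed.

Lemma presented_ptr k l (i : 'I_k.+1) (j : 'I_l.+1) (p : iso_classes S k.+1 l.+1) D :
  presented p D -> presented (ptr T i j p) (wptr i j D).
Proof.
move=> pD; apply/presented_class/(wiso_trans (wiring_of_ptr _ _ _ _)).
exact: wptr_congr.
Qed.

Lemma class_ops_induced : induced_ops T.
Proof.
split=> *; rewrite ?[RHS]/=; apply: presented_inj (wiso_refl _ _ _);
  [|apply: presented_class|
   |apply: presented_class|
   |apply: presented_class|
   |apply: presented_class|
   |apply: presented_class].
- apply: presented_lact; apply: presented_class; exact: wiso_refl.
- exact: wiring_of_lact.
- apply: presented_ract; apply: presented_class; exact: wiso_refl.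
- exact: wiring_of_ract.
- apply: presented_hcat; apply: presented_class; exact: wiso_refl.
- exact: wiring_of_hcat.
- exact: presented_hone.
- exact: wiring_of_hone.
- apply: presented_ptr; apply: presented_class; exact: wiso_refl.
- exact: wiring_of_ptr.
Qed.

(** An axiom equates two expressions in the operations; this reads off from
    each of them the wiring that presents it. *)
Ltac find_presentation :=
  lazymatch goal with
  | |- presented (cast2 _ _ _) _ => eapply presented_cast; find_presentation
  | |- presented (lact _ _ _) _ => eapply presented_lact; find_presentation
  | |- presented (ract _ _ _) _ => eapply presented_ract; find_presentation
  | |- presented (hcat _ _ _) _ =>
    first [eapply presented_hcat | eapply presented_hcatS | eapply presented_hcat1];
    find_presentation
  | |- presented (hone _) _ => exact presented_hone
  | |- presented (ptr _ _ _ _) _ => eapply presented_ptr; find_presentation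
  | |- presented (iso_class (sgraph_wire _)) _ => exact presented_wire
  | |- presented _ _ => exact (presented_repr _)
  end.

Ltac present := eapply presented_inj; [find_presentation | find_presentation | ].

Lemma class_ptr_ptr k l (p : iso_classes S k.+2 l.+2) (i i2 : 'I_k.+2) (j j2 : 'I_l.+2)
    (i' i1 : 'I_k.+1) (j' j1 : 'I_l.+1) :
  i2 = bump i i' :> nat -> i = bump i2 i1 :> nat ->
  j2 = bump j j' :> nat -> j = bump j2 j1 :> nat ->
  ptr T i' j' (ptr T i j p) = ptr T i1 j1 (ptr T i2 j2 p).
Proof.
by move=> *; present; apply: wptr_wptr => //; exact: wired_inj.
Qed.

Lemma class_ops_trap : is_trap T.
Proof.
split=> [k l p|k l s t p|k l p|k l s t p|k l s t p
        |k l k' l' k'' l'' p p' p''|k l p|k l p|k l k' l' s p t s' p' t'|k l k' l' p p'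
        |k l p i j i' j' ii' jj'|k l p i j i' j' ii' jj'
        |k l p i j i' j' ii' jj'|k l p i j i' j' ii' jj'
        |k l s p t i j|k l k' l' p p' i j|k l k' l' p p' i j].
- present; exact: wlact1.
- present; exact: wlactM.
- present; exact: wract1.
- present; exact: wractM.
- present; exact: wiso_refl.
- present; exact: wcatA.
- present; exact: wcat1w.
- by present; rewrite -{1}[k]addn0 -{1}[l]addn0; exact: wcatw1.
- present; exact: wcat_act.
- present; exact: wcatC.
- apply: class_ptr_ptr; rewrite /bump !inordK; move: (ltn_ord i) (ltn_ord j); lia.
- apply: class_ptr_ptr; rewrite /bump !inordK;
    move: (ltn_ord i) (ltn_ord j) (ltn_ord i'); lia.
- apply: class_ptr_ptr; rewrite /bump !inordK;
    move: (ltn_ord i) (ltn_ord j) (ltn_ord j'); lia.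
- apply: class_ptr_ptr; rewrite /bump !inordK; move: (ltn_ord i') (ltn_ord j'); lia.
- present; exact: wptr_act.
- by present; apply: wptr_catl; rewrite /= -ltnS ltn_ord.
- present; exact: wptr_catr.
Qed.

Lemma class_ops_unit : is_unit T (iso_class (sgraph_wire S)).
Proof.
split=> k l p i lt_i; present.
- apply: wptr_unitl_out; have := ltn_ord i; lia.
- apply: wptr_unitl_in; have := ltn_ord i; lia.
- exact: wptr_unitr_out.
- exact: wptr_unitr_in.
Qed.

End Quotient.

Theorem iso_classes_unitary_trap (S : graph_structure) (L : local_structure S) :
  exists T : trap_ops (iso_classes S),
    induced_ops T /\ is_trap T /\ is_unit T (iso_class (sgraph_wire S)).
Proof.
exists (class_ops S); split; [exact: class_ops_induced L | split].
  exact: class_ops_trap L.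
exact: class_ops_unit L.
Qed.

Theorem proposition3p2p1 (X : nat -> nat -> Type) :
  (exists T : trap_ops Gr,
     induced_ops T /\ is_trap T /\ is_unit T (iso_class (sgraph_wire no_structure))) /\
  (exists T : trap_ops CGr,
     induced_ops T /\ is_trap T /\ is_unit T (iso_class (sgraph_wire corolla_structure))) /\
  (exists T : trap_ops (GrX X),
     induced_ops T /\ is_trap T /\
     is_unit T (iso_class (sgraph_wire (decoration_structure X)))) /\
  (exists T : trap_ops (CGrX X),
     induced_ops T /\ is_trap T /\
     is_unit T (iso_class (sgraph_wire
       (pair_structure corolla_structure (decoration_structure X))))).
Proof.
split; [|split; [|split]]; apply: iso_classes_unitary_trap.
- exact: no_structure_local.
- exact: corolla_structure_local.
- exact: decoration_structure_local.
- exact: corolla_decoration_structure_local.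
Qed.
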